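(* Let $m\ge1$ and let $\pi$ be an irreducible cuspidal representation of $\mathrm{GL}_{2m+1}(\mathbb F)$. Then $$\gamma(\pi,\wedge^2,\psi)=q^{\frac m2+2\binom m2}\sum_{\substack{m_1,\dots,m_r\ge1\\ m_1+\dots+m_r=m\\ \lambda_1,\dots,\lambda_r\in\mathbb F^*}}q^{-\sum_{i=1}^r2\binom{m_i}2}\cdot\mathcal B_{\pi,\psi}\left(\mathrm{antidiag}(\lambda_1I_{2m_1},\dots,\lambda_rI_{2m_r},I_1)^{-1}\right),$$ where the sum runs over all $r\ge1$, all ordered tuples $(m_1,\dots,m_r)$ of positive integers with sum $m$, and all $(\lambda_1,\dots,\lambda_r)\in(\mathbb F^* )^r$.
   Context: $\mathbb F$ is a finite field with $q$ elements and $\psi:\mathbb F\to\mathbb C^*$ is a non-trivial additive character. $M=M_m(\mathbb F)$, $G=\mathrm{GL}_m(\mathbb F)$, $\mathcal B\subseteq M$ is the subspace of upper triangular matrices, $N\le G$ the upper triangular unipotent subgroup; $N_n\le\mathrm{GL}_n(\mathbb F)$ is the upper triangular unipotent subgroup and $\psi(u)=\psi(\sum_iu_{i,i+1})$ for $u\in N_n$. $\mathcal S(\mathbb F^m)$ is the space of all functions $\mathbb F^m\to\mathbb C$, and $\mathcal F_\psi\phi(y)=q^{-m/2}\sum_{x}\phi(x)\psi(\langle x,y\rangle)$ with the standard bilinear form. For an irreducible generic representation $\pi$ of $\mathrm{GL}_n(\mathbb F)$ (irreducible cuspidal representations are generic), $\mathcal W(\pi,\psi)$ is its Whittaker model: the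 functions $g\mapsto\ell(\pi(g)v)$, $v\in V_\pi$, where $0\ne\ell\in\mathrm{Hom}_{N_n}(\pi,\psi)$; $\mathrm{GL}_n(\mathbb F)$ acts by right translation. $\tilde W(g)=W(w_n\,{}^tg^{-1})\in\mathcal W(\tilde\pi,\psi^{-1})$, where $w_n$ is the matrix with ones on the antidiagonal and $\tilde\pi$ is the contragredient. The Bessel function $\mathcal B_{\pi,\psi}$ is the unique element of $\mathcal W(\pi,\psi)$ with $\mathcal B_{\pi,\psi}(I_n)=1$ and $\mathcal B_{\pi,\psi}(u_1gu_2)=\psi(u_1)\psi(u_2)\mathcal B_{\pi,\psi}(g)$ for all $g\in\mathrm{GL}_n(\mathbb F)$, $u_1,u_2\in N_n$. For $g_i\in\mathrm{GL}_{n_i}(\mathbb F)$, $\mathrm{antidiag}(g_1,\dots,g_r)$ is the block matrix with blocks $g_1,\dots,g_r$ on the block antidiagonal, $g_1$ in the top right corner and $g_r$ in the bottom left corner, zeros elsewhere. Jacquet–Shalika integral for $n=2m+1$: $$J_{\pi,\psi}(W,\phi)=\frac1{[G:N][M:\mathcal B]\,|M_{1\times m}(\mathbb F)|}\sum_{g\in N\backslash G}\sum_{X\in\mathcal B\backslash M}\sum_{Z\in M_{1\times m}(\mathbb F)}W\left(\sigma_{2m+1}\begin{pmatrix}I_m&X&\\ &I_m&\\ &&1\end{pmatrix}\begin{pmatrix}g&&\\ &g&\\ &&1\end{pmatrix}\begin{pmatrix}I_m&&\\ &I_m&\\ &Z&1\end{pmatrix}\right)\psi(-\mathrm{tr}X)\phi(Z),$$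 where $\sigma_{2m+1}$ is the permutation matrix whose $j$-th column is $e_{\sigma(j)}$, with $\sigma(j)=2j-1$, $\sigma(m+j)=2j$ for $1\le j\le m$ and $\sigma(2m+1)=2m+1$. The dual is $\tilde J_{\pi,\psi}(W,\phi)=J_{\tilde\pi,\psi^{-1}}\left(\tilde\pi\begin{pmatrix}&I_m&\\ I_m&&\\ &&1\end{pmatrix}\tilde W,\mathcal F_\psi\phi\right)$. The exterior square gamma factor $\gamma(\pi,\wedge^2,\psi)\in\mathbb C^*$ of the irreducible cuspidal representation $\pi$ is the unique non-zero constant (it exists) such that $\tilde J_{\pi,\psi}(W,\phi)=\gamma(\pi,\wedge^2,\psi)J_{\pi,\psi}(W,\phi)$ for all $W\in\mathcal W(\pi,\psi)$, $\phi\in\mathcal S(\mathbb F^m)$. *)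

(* Defs.v *)
From HB Require Import structures.
From mathcomp Require Import all_boot all_order all_algebra all_fingroup.
From mathcomp Require Import mxrepresentation.

Set Implicit Arguments.
Unset Strict Implicit.
Unset Printing Implicit Defensive.

Import Order.TTheory GRing.Theory Num.Theory.
Local Open Scope ring_scope.

(* The element of GL_n given by the matrix A; the junk value 1 is taken only  *)
(* if A is singular, which never happens below.                               *)
Definition toGL (F : finFieldType) (n : nat) (A : 'M[F]_n.-1.+1) :
  {'GL_n[F]} :=
  insubd (1%g : {unit 'M[F]_n.-1.+1}) A.

Section AdditiveCharacter.

Variables (F : finFieldType) (C : numClosedFieldType) (psi : F -> C).

Definition additive_character : Prop :=
  psi 0 = 1 /\ {morph psi : x y / x + y >-> x * y}.

Definition nontrivial_character : Prop := exists x, psi x != 1.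

Definition inv_character : F -> C := fun x => (psi x)^-1.

(* psi(u) = psi(sum_i u_{i,i+1}) *)
Definition psi_unip (n : nat) (u : {'GL_n[F]}) : C :=
  psi (\sum_(i < n.-1.+1) \sum_(j < n.-1.+1 | j == i.+1 :> nat) GLval u i j).

Definition Fourier (m : nat) (phi : 'rV[F]_m -> C) (y : 'rV[F]_m) : C :=
  (sqrtC #|F|%:R) ^- m * \sum_(x : 'rV[F]_m) phi x * psi ((x *m y^T) 0 0).

End AdditiveCharacter.

Definition unip (F : finFieldType) (n : nat) : {set {'GL_n[F]}} :=
  [set u | [forall i : 'I_n.-1.+1, forall j : 'I_n.-1.+1,
     (j <= i)%N ==> (GLval u i j == (i == j)%:R)]].

(* The unipotent radical of the standard parabolic subgroup attached to the   *)
(* composition s of n: reshape_index s i is the block containing the index i. *)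
Definition unip_radical (F : finFieldType) (n : nat) (s : seq nat) :
  {set {'GL_n[F]}} :=
  [set u | [forall i : 'I_n.-1.+1, forall j : 'I_n.-1.+1,
     (reshape_index s j <= reshape_index s i)%N
       ==> (GLval u i j == (i == j)%:R)]].

(* The matrices rG g act on the left on the space V = 'cV[C]_d; linear forms  *)
(* on V are the row vectors 'rV[C]_d. The predicate mx_irreducible is about   *)
(* invariant spaces of row vectors; taking annihilators, it amounts to the    *)
(* irreducibility of V.                                                       *)
(* The field C of coefficients may be any algebraically closed field with a   *)
(* conjugation and a norm, such as R[i] for a real closed field R.            *)
Section Representation.

Variables (F : finFieldType) (C : numClosedFieldType) (n d : nat).
Variable rG : mx_representation C 'GL_n[F] d.

Definition cuspidal : Prop :=
  forall s : seq nat,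
    sumn s = n -> all (fun k => 0 < k)%N s -> (1 < size s)%N ->
  forall v : 'cV[C]_d,
    (forall u, u \in unip_radical F n s -> rG u *m v = v) -> v = 0.

Variable psi : F -> C.

Definition Whittaker_functional (l : 'rV[C]_d) : Prop :=
  forall u, u \in unip F n -> l *m rG u = psi_unip psi u *: l.

(* Membership in W(pi, psi); l is unique up to a nonzero scalar when pi is    *)
(* irreducible, so that the model does not depend on it.                      *)
Definition Whittaker_model (W : {'GL_n[F]} -> C) : Prop :=
  exists l : 'rV[C]_d, exists v : 'cV[C]_d,
    [/\ l != 0, Whittaker_functional l
      & forall g, W g = (l *m (rG g *m v)) 0 0].

Definition is_Bessel (B : {'GL_n[F]} -> C) : Prop :=
  [/\ Whittaker_model B, B 1%g = 1
    & forall g u1 u2, u1 \in unip F n -> u2 \in unip F n ->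
        B (u1 * g * u2)%g = psi_unip psi u1 * psi_unip psi u2 * B g].

End Representation.

Definition wlong (F : finFieldType) (n : nat) : 'M[F]_n :=
  \matrix_(i, j) (j == rev_ord i)%:R.

Definition tildeW (F : finFieldType) (C : numClosedFieldType) (n : nat)
    (W : {'GL_n[F]} -> C) : {'GL_n[F]} -> C :=
  fun g => W (toGL (wlong F n.-1.+1 *m (invmx (GLval g))^T)).

Definition rtrans (F : finFieldType) (C : numClosedFieldType) (n : nat)
    (h : {'GL_n[F]}) (W : {'GL_n[F]} -> C) : {'GL_n[F]} -> C :=
  fun g => W (g * h)%g.

(* Throughout, m = k.+1, so that m >= 1, and 2m+1 is written m + m + 1.       *)
Section JacquetShalika.

Variables (F : finFieldType) (C : numClosedFieldType) (k : nat).
Local Notation m := k.+1.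
Local Notation n := (k.+1 + k.+1 + 1)%N.

Definition upper_trig : {set 'M[F]_m} :=
  [set X : 'M[F]_m |
     [forall i : 'I_m, forall j : 'I_m, (j < i)%N ==> (X i j == 0)]].

(* With indices counted from 0, sigma is j |-> 2j and m + j |-> 2j+1 for      *)
(* j < m, and 2m |-> 2m.                                                      *)
Definition sigma (j : nat) : nat :=
  if (j < m)%N then j.*2 else if (j < m.*2)%N then (j - m).*2.+1 else j.

Definition sigma_mx : 'M[F]_n := \matrix_(i, j) (i == sigma j :> nat)%:R.

Definition JS_arg (g X : 'M[F]_m) (Z : 'rV[F]_m) : 'M[F]_n :=
  sigma_mx
    *m block_mx (block_mx 1%:M X 0 1%:M) 0 0 1%:M
    *m block_mx (block_mx g 0 0 g) 0 0 1%:M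
    *m block_mx 1%:M 0 (row_mx 0 Z) 1%:M.

Variable psi : F -> C.

(* J(W, phi); rcosets is taken in the group GL_m for N \ G, and in the        *)
(* additive group of 'M[F]_m for upper_trig \ M.                              *)
Definition JS (W : {'GL_n[F]} -> C) (phi : 'rV[F]_m -> C) : C :=
  (#|'GL_m[F] : unip F m|%g%:R * #|[set: 'M[F]_m] : upper_trig|%g%:R
     * #|{: 'rV[F]_m}|%:R)^-1
  * \sum_(Ng in rcosets (unip F m) 'GL_m[F])
    \sum_(BX in rcosets upper_trig [set: 'M[F]_m])
    \sum_(Z : 'rV[F]_m)
      W (@toGL F n (JS_arg (GLval (repr Ng)) (repr BX) Z))
        * psi (- \tr (repr BX)) * phi Z.

Definition swap_mx : 'M[F]_n :=
  block_mx (block_mx 0 1%:M 1%:M 0) 0 0 1%:M.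

End JacquetShalika.

Definition dualJS (F : finFieldType) (C : numClosedFieldType) (k : nat)
    (psi : F -> C) (W : {'GL_(k.+1 + k.+1 + 1)[F]} -> C)
    (phi : 'rV[F]_k.+1 -> C) : C :=
  JS (inv_character psi) (rtrans (@toGL F (k.+1 + k.+1 + 1) (swap_mx F k)) (tildeW W))
     (Fourier psi phi).

Definition is_ext_square_gamma (F : finFieldType) (C : numClosedFieldType)
    (k d : nat) (rG : mx_representation C 'GL_(k.+1 + k.+1 + 1)[F] d)
    (psi : F -> C) (gamma : C) : Prop :=
  gamma != 0 /\
  forall (W : {'GL_(k.+1 + k.+1 + 1)[F]} -> C) (phi : 'rV[F]_k.+1 -> C),
    Whittaker_model rG psi W ->
    dualJS psi W phi = gamma * JS psi W phi.

Section Antidiag.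

Variable F : finFieldType.

Definition block := {p : nat & 'M[F]_p}.

Definition mkblock (p : nat) (g : 'M[F]_p) : block :=
  Tagged (fun p => 'M[F]_p) g.

Fixpoint antidiag_size (s : seq block) : nat :=
  if s is b :: s' then (tag b + antidiag_size s')%N else 0.

(* The head of s is the top right block. *)
Fixpoint antidiag (s : seq block) : 'M[F]_(antidiag_size s) :=
  if s is b :: s' return 'M[F]_(antidiag_size s) then
    castmx (erefl _, addnC (antidiag_size s') (tag b))
      (block_mx 0 (tagged b) (antidiag s') 0)
  else 0.

(* antidiag(lam_1 I_{2 mu_1}, ..., lam_r I_{2 mu_r}, I_1), of size 2m+1 if    *)
(* sum_i mu_i = m = k.+1; in that case conform_mx is a mere cast of           *)
(* dimensions.                                                                *)
Definition antidiag_scal (k r : nat) (mu : {ffun 'I_r -> 'I_k.+2})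
    (lam : {ffun 'I_r -> {unit F}}) : 'M[F]_(k.+1 + k.+1 + 1) :=
  conform_mx 0
    (antidiag (rcons [seq mkblock ((FinRing.uval (lam i))%:M : 'M[F]_(2 * mu i))
                       | i <- enum 'I_r] (mkblock (1%:M : 'M[F]_1)))).

End Antidiag.

(* Main.v *)
Require Import Defs.
From HB Require Import structures.
From mathcomp Require Import all_boot all_order all_algebra all_fingroup.
From mathcomp Require Import mxrepresentation zify ring.

Set Implicit Arguments.
Unset Strict Implicit.
Unset Printing Implicit Defensive.

Import Order.TTheory GRing.Theory Num.Theory.
Local Open Scope ring_scope.

(** The functional equation determines gamma as soon as the two sums J and its
    dual are known for one pair (W, phi). Take for W the translate
    h |-> B (h sigma^-1) of the Bessel function, and for phi the indicator
    function of 0, whose Fourier transform is the constant q^(-m/2).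

    Averaging over cosets turns both sums into sums over the Shalika subgroup,
      T(f) = sum over g in GL_m and X in M_m of
             f [g, X g; 0, g] psi (- tr X),
    where f Y is B (diag (Y, 1)) for J and B (antidiag (1, Y)) for the dual
    ([JS_numerator], [JS_dual]): in the dual, the long Weyl element and the
    swap of the two blocks amount to a cyclic shift of the places and a reversal
    inside each block, which the substitution g |-> w g^-T, X |-> - w X^T w
    undoes, and the summands do not depend on Z. Here the coordinates j and
    m + j of Y are interleaved. In both cases f is equivariant on both sides
    under the unitriangular subgroup of GL_2m, and T(f) can be computed from
    this property alone ([Shalika_sum]):

    - By the Bruhat decomposition g runs over monomial matrices n^-1, counted
      with the sizes of their double cosets.
    - The part of X which is upper triangular, on either side of n^-1, is
      absorbed by the equivariance of f. If anything else is left of X, then a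
      unipotent matrix crosses the argument of f with a nontrivial character,
      and the term vanishes ([not_absorbed_term]). Only X = 0 remains, counted
      with a power of q.
    - For X = 0 the simple roots of GL_2m which join consecutive coordinates of
      GL_m force n to be block antidiagonal with scalar blocks
      ([biequiv_monomial_supp], [composition_exists]). Both powers of q are
      governed by the number of pairs of rows inside one block, which is the
      sum of the binomials 'C(m_i, 2).

    For the dual this is the sum of the statement, as the argument
    antidiag (1, n^-1) is the inverse of antidiag (n, 1). For J one more root,
    in the last column, leaves the single term n = 1 ([f0_monomial_supp]), with
    value B 1 = 1. The quotient of the two sums is gamma. *)

(** * Additive characters *)

Section Characters.

Variables (F : finFieldType) (C : numClosedFieldType) (psi : F -> C).
Hypothesis psi_char : additive_character psi.

Lemma char0 : psi 0 = 1. Proof. by case: psi_char. Qed.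

Lemma charD x y : psi (x + y) = psi x * psi y.
Proof. by case: psi_char => _ ->. Qed.

Lemma char_neq0 x : psi x != 0.
Proof.
apply/eqP => x0; have /eqP := charD x (- x).
by rewrite subrr char0 x0 mul0r oner_eq0.
Qed.

Lemma charN x : psi (- x) = (psi x)^-1.
Proof.
by apply: (mulIf (char_neq0 x)); rewrite -charD addNr char0 mulVf ?char_neq0.
Qed.

Hypothesis psi_nontrivial : nontrivial_character psi.

Lemma char_scale_nontrivial a : a != 0 -> exists c, psi (c * a) != 1.
Proof. by move=> a0; case: psi_nontrivial => x px; exists (x / a); rewrite divfK. Qed.

End Characters.

(** * Unitriangular matrices *)

Section Triangular.

Variable F : finFieldType.

Definition unitri n (U : 'M[F]_n) : Prop :=
  forall i j : 'I_n, (j <= i)%N -> U i j = (i == j)%:R.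

Definition strict_utri n (L : 'M[F]_n) : Prop :=
  forall i j : 'I_n, (j <= i)%N -> L i j = 0.

Definition utri n (X : 'M[F]_n) : Prop :=
  forall i j : 'I_n, (j < i)%N -> X i j = 0.

Definition supdiag n (A : 'M[F]_n) : F :=
  \sum_(i < n) \sum_(j < n | j == i.+1 :> nat) A i j.

Lemma unitri1 n : @unitri n 1%:M.
Proof. by move=> i j _; rewrite mxE. Qed.

Lemma supdiag1 n : supdiag (1%:M : 'M[F]_n) = 0.
Proof.
rewrite /supdiag big1 // => i _; rewrite big1 // => j /eqP ji; rewrite mxE.
by case: eqP ji => // ->; lia.
Qed.

Lemma det_unitri n (U : 'M[F]_n) : unitri U -> \det U = 1.
Proof.
move=> Uu; rewrite -det_tr det_trig; last first.
  by apply/is_trig_mxP => i j ij; rewrite mxE Uu ?(ltnW ij) // gt_eqF.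
by apply: big1 => i _; rewrite mxE Uu // eqxx.
Qed.

Lemma unitri_unit n (U : 'M[F]_n) : unitri U -> U \in unitmx.
Proof. by move=> Uu; rewrite unitmxE det_unitri ?unitr1. Qed.

Lemma utri_mul n (A B : 'M[F]_n) : utri A -> utri B -> utri (A *m B).
Proof.
move=> tA tB i j ij; rewrite mxE big1 // => l _.
by case: (ltnP l i) => li; [rewrite tA ?mul0r | rewrite tB ?mulr0 // (leq_trans ij)].
Qed.

Lemma unitri_utri n (U : 'M[F]_n) : unitri U -> utri U.
Proof. by move=> Uu i j ij; rewrite Uu ?(ltnW ij) // gt_eqF. Qed.

Lemma unitri_mul n (A B : 'M[F]_n) : unitri A -> unitri B -> unitri (A *m B).
Proof.
move=> uA uB i j; rewrite leq_eqVlt => /orP[/eqP ij|ij]; last first.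
  by rewrite utri_mul ?gt_eqF //; apply: unitri_utri.
have {}ij: i = j by apply: val_inj.
rewrite -{}ij {j} eqxx mxE (bigD1 i) //= !uA // !uB // eqxx mulr1 big1 ?addr0 // => l li.
case: (ltngtP l i) => [{}li|{}li|/val_inj lE]; last by rewrite lE eqxx in li.
  by rewrite uA ?(ltnW li) // gt_eqF ?mul0r.
by rewrite uB ?(ltnW li) // gt_eqF ?mulr0.
Qed.

End Triangular.

Lemma unipP (F : finFieldType) n (u : {'GL_n[F]}) :
  reflect (unitri (GLval u)) (u \in unip F n).
Proof.
rewrite inE; apply: (iffP 'forall_forallP) => [uu i j ij|uu i j].
  by apply/eqP; apply: (implyP (uu i j)).
by apply/implyP => ij; rewrite uu.
Qed.

Lemma upper_trigP (F : finFieldType) k (X : 'M[F]_k.+1) :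
  reflect (utri X) (X \in upper_trig F k).
Proof.
rewrite inE; apply: (iffP 'forall_forallP) => [uu i j ij|uu i j].
  by apply/eqP; apply: (implyP (uu i j)).
by apply/implyP => ij; rewrite uu.
Qed.

Lemma unip_group_set (F : finFieldType) n : group_set (unip F n).
Proof.
apply/group_setP; split=> [|u v /unipP uu /unipP uv]; apply/unipP.
  exact: unitri1.
exact: unitri_mul.
Qed.
Canonical unip_group (F : finFieldType) n := Group (unip_group_set F n).

Lemma upper_trig_group_set (F : finFieldType) k : group_set (upper_trig F k).
Proof.
apply/group_setP; split=> [|u v /upper_trigP uu /upper_trigP uv]; apply/upper_trigP.
  by move=> i j ij; rewrite mxE.
by move=> i j ij; rewrite mxE uu ?uv ?addr0.
Qed.
Canonical upper_trig_group (F : finFieldType) k := Group (upper_trig_group_set F k).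

Lemma unitri_inv (F : finFieldType) n (U : 'M[F]_n) : unitri U -> unitri (invmx U).
Proof.
move=> uU i; move E: (n - i)%N => d; elim/ltn_ind: d i E => d IHd i E j ji.
have := congr1 (fun A : 'M[F]_n => A i j) (mulmxV (unitri_unit uU)).
rewrite !mxE (bigD1 i) //= uU // eqxx mul1r big1 ?addr0 // => l nl.
case: (ltngtP l i) => [li|il|/val_inj lE]; last by rewrite lE eqxx in nl.
  by rewrite uU ?(ltnW li) // gt_eqF ?mul0r.
have jl : (j < l)%N := leq_ltn_trans ji il.
by rewrite (IHd (n - l)%N) ?(ltnW jl) // ?gt_eqF ?mulr0 //; have := ltn_ord l; lia.
Qed.

Lemma toGLK (F : finFieldType) n (A : 'M[F]_n.-1.+1) :
  A \in unitmx -> GLval (toGL A) = A.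
Proof. by move=> uA; rewrite /toGL; apply: insubdK. Qed.

Lemma toGL_mul (F : finFieldType) n (A B : 'M[F]_n.-1.+1) :
  A \in unitmx -> B \in unitmx -> toGL (A *m B) = (toGL A * toGL B)%g.
Proof.
move=> uA uB; apply: val_inj; rewrite [LHS]toGLK ?unitmx_mul ?uA //.
by rewrite [RHS]GL_MxE !toGLK.
Qed.

(** * The Bruhat decomposition *)

Section Bruhat.

Variable F : finFieldType.

Definition monomial n (v : 'S_n) (t : {ffun 'I_n -> {unit F}}) : 'M[F]_n :=
  \matrix_(i, j) (val (t i) * (j == v i)%:R).

Lemma unitF_neq0 (x : {unit F}) : val x != 0.
Proof. by rewrite -unitfE; apply: (valP x). Qed.

Lemma monomialP n (v : 'S_n) t i : @monomial n v t i (v i) = val (t i).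
Proof. by rewrite mxE eqxx mulr1. Qed.

Lemma mul_monomial n v t (A : 'M[F]_n) i j :
  (monomial v t *m A) i j = val (t i) * A (v i) j.
Proof.
rewrite mxE (bigD1 (v i)) //= monomialP big1 ?addr0 // => l li.
by rewrite mxE (negPf li) mulr0 mul0r.
Qed.

Lemma mulmx_monomial n v t (A : 'M[F]_n) i j :
  (A *m monomial v t) i (v j) = A i j * val (t j).
Proof.
rewrite mxE (bigD1 j) //= monomialP big1 ?addr0 // => l li.
by rewrite mxE (inj_eq perm_inj) eq_sym (negPf li) !mulr0.
Qed.

Lemma monomial_unit n v t : @monomial n v t \in unitmx.
Proof.
pose B : 'M[F]_n := \matrix_(i, j) ((val (t j))^-1 * (i == v j)%:R).
have: monomial v t *m B = 1%:M.
  apply/matrixP => i j; rewrite mul_monomial !mxE (inj_eq perm_inj).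
  by case: eqP => [->|_]; rewrite ?mulr0 // mulr1 divff ?unitF_neq0.
by case/mulmx1_unit.
Qed.

(** Clearing with the lowest nonzero entry of a column only adds multiples of
    a row to higher rows and of a column to columns further right. *)
Lemma clear_column n (A : 'M[F]_n) (i c : 'I_n) :
    A i c != 0 -> (forall i' : 'I_n, (i < i')%N -> A i' c = 0) ->
    (forall j : 'I_n, (j < c)%N -> A i j = 0) ->
  exists U V : 'M[F]_n, [/\ unitri U, unitri V &
    forall a b, (U *m A *m V) a b =
      if b == c then (if a == i then A i c else 0)
      else if a == i then 0 else A a b - A a c / A i c * A i b].
Proof.
move=> Aic low left.
pose U : 'M[F]_n := \matrix_(a, b) ((a == b)%:R - (a != i)%:R * (A a c / A i c) * (b == i)%:R).
pose V : 'M[F]_n := \matrix_(a, b) ((a == b)%:R - (a == c)%:R * (b != c)%:R * (A i b / A i c)).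
exists U, V; split.
- move=> a b ba; rewrite mxE; case: (b =P i) => [bi|_]; rewrite ?mulr0 ?subr0 //.
  case: (a =P i) => [_|/eqP ai] /=; rewrite ?mul0r ?subr0 //.
  rewrite low ?mul0r ?mulr0 ?mul0r ?subr0 // -bi ltn_neqAle ba andbT.
  by move: ai; rewrite -bi eq_sym.
- move=> a b ba; rewrite mxE; case: (a =P c) => [ac|_]; rewrite ?mul0r ?subr0 //.
  case: (b =P c) => [_|/eqP bc] /=; rewrite ?mulr0 ?mul0r ?subr0 //.
  rewrite left ?mul0r ?mulr0 ?subr0 // ltn_neqAle -ac ba andbT.
  by move: bc; rewrite -ac.
have UA a b : (U *m A) a b = A a b - (a != i)%:R * (A a c / A i c) * A i b.
  rewrite mxE; under eq_bigr do rewrite mxE mulrBl.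
  rewrite big_split /= (bigD1 a) //= eqxx mul1r big1 ?addr0; last first.
    by move=> l /negPf la; rewrite eq_sym la mul0r.
  congr (_ + _); rewrite sumrN (bigD1 i) //= eqxx mulr1 big1 ?addr0 //.
  by move=> l /negPf ->; rewrite mulr0 mul0r.
have UAc a : (U *m A) a c = if a == i then A i c else 0.
  rewrite UA; case: (a =P i) => [->|_]; first by rewrite !mul0r subr0.
  by rewrite mul1r divfK ?subrr.
move=> a b; rewrite mxE; under eq_bigr do rewrite [V _ _]mxE mulrBr.
rewrite big_split /= (bigD1 b) //= eqxx mulr1 big1 ?addr0; last first.
  by move=> l /negPf ->; rewrite mulr0.
rewrite sumrN (bigD1 c) //= eqxx mul1r [X in _ - (_ + X)]big1 ?addr0; last first.
  by move=> l /negPf ->; rewrite !mul0r mulr0.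
case: (b =P c) => [->|_] /=; first by rewrite mul0r mulr0 subr0 UAc.
rewrite mul1r UAc UA; case: (a =P i) => [->|_] /=.
  by rewrite !mul0r subr0 mulrCA divff // mulr1 subrr.
by rewrite mul1r !mul0r subr0.
Qed.

(** The situation of a pivot once its row and its column are cleared. *)
Definition isolated n (A : 'M[F]_n) (i j : 'I_n) : Prop :=
  [/\ A i j != 0, forall i', i' != i -> A i' j = 0
    & forall j', j' != j -> A i j' = 0].

(** Columns are treated from left to right. The pivot row of an earlier column
    vanishes in the current one, so that clearing the current column leaves the
    earlier pivots untouched. *)
Lemma isolated_columns n (A : 'M[F]_n) c : A \in unitmx -> (c <= n)%N ->
  exists U V : 'M[F]_n, [/\ unitri U, unitri V &
    forall j : 'I_n, (j < c)%N -> exists i, isolated (U *m A *m V) i j].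
Proof.
move=> uA; elim: c => [|c IHc] cn.
  by exists 1%:M, 1%:M; split => //; apply: unitri1.
have [U [V [uU uV iso]]] := IHc (ltnW cn).
set A' := U *m A *m V in iso.
have uA' : A' \in unitmx by rewrite !unitmx_mul uA !unitri_unit.
pose j0 := Ordinal cn.
have [i Ai low] : exists2 i : 'I_n, A' i j0 != 0 & forall i' : 'I_n, (i < i')%N -> A' i' j0 = 0.
  have [i1 Ai1] : exists i, A' i j0 != 0.
    apply/existsP; apply: contraLR uA' => /existsPn Aj0.
    rewrite unitmxE unitfE negbK -det_tr (expand_det_row _ j0) big1 // => i _.
    by rewrite mxE (eqP (negbNE (Aj0 i))) mul0r.
  case: (arg_maxnP (P := fun i => A' i j0 != 0) (@nat_of_ord n) Ai1) => i Ai max_i; exists i => // i' ii'.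
  apply/eqP; apply/negPn/negP => /max_i; apply/negP; rewrite -ltnNge; exact: ii'.
have left (j : 'I_n) : (j < j0)%N -> A' i j = 0.
  move=> ltj; have [a [Aa col row]] := iso _ ltj.
  apply: col; apply: contraNneq Ai => ->.
  by rewrite row //; apply: contraTneq ltj => <-; rewrite ltnn.
have [U' [V' [uU' uV' E]]] := clear_column Ai low left.
exists (U' *m U), (V *m V'); split; try exact: unitri_mul.
have -> : U' *m U *m A *m (V *m V') = U' *m A' *m V' by rewrite /A' !mulmxA.
move=> j; rewrite ltnS leq_eqVlt => /orP[/eqP jc|ltj].
  have {jc}-> : j = j0 by apply: val_inj.
  by exists i; split=> [|i' ni|j' nj]; rewrite E eqxx ?eqxx // ?(negPf ni) // (negPf nj).
have nj0 : j != j0 by apply: contraTneq ltj => ->; rewrite ltnn.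
have [r [Ar col row]] := iso _ ltj.
have nr : r != i by apply: contraNneq Ai => <-; rewrite row // eq_sym.
have Erc : A' r j0 = 0 by rewrite row // eq_sym.
exists r; split=> [|a na|b nb]; rewrite E.
- by rewrite (negPf nj0) (negPf nr) Erc mul0r mul0r subr0.
- by rewrite (negPf nj0) (left _ ltj) mulr0 subr0 col //; case: ifP.
- by rewrite (negPf nr) Erc !mul0r subr0 row // !if_same.
Qed.

Lemma Bruhat_exists n (A : 'M[F]_n) : A \in unitmx ->
  exists U V v t, [/\ unitri U, unitri V & U *m A *m V = monomial v t].
Proof.
move=> uA; have [U [V [uU uV iso]]] := isolated_columns uA (leqnn n).
set A' := U *m A *m V in iso.
have /fin_all_exists[w isow] : forall j : 'I_n, exists i, isolated A' i j.
  by move=> j; apply: iso.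
have w_inj : injective w.
  move=> j j' E; have [Aj _ _] := isow j; have [_ _ row] := isow j'.
  by apply/eqP; apply: contraNT Aj => nj; rewrite E row.
pose v := ((perm w_inj)^-1)%g.
have isov i : isolated A' i (v i).
  have := isow (v i); have <- // : i = w (v i).
  by rewrite -[RHS](permE w_inj) permKV.
pose t : {ffun 'I_n -> {unit F}} := [ffun i => insubd (1%g : {unit F}) (A' i (v i))].
exists U, V, v, t; split=> //; apply/matrixP => i j; rewrite [RHS]mxE ffunE insubdK.
  case: eqP => [->|/eqP nj]; first by rewrite mulr1.
  by rewrite mulr0; have [_ _ ->] := isov i.
by rewrite unfold_in unitfE; have [] := isov i.
Qed.

(** The numbers i and z i have the same sum, so that no inequality is strict. *)
Lemma perm_ge_id n (z : 'S_n) : (forall i : 'I_n, (i <= z i)%N) -> z = 1%g.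
Proof.
move=> le_z; apply/permP => i; rewrite perm1; apply/val_inj/eqP; rewrite eq_sym /=.
have /leqif_sum[_] : forall i : 'I_n, true -> (i <= z i ?= iff (val i == z i))%N.
  by move=> j _; split=> //; apply: le_z.
rewrite [X in X == _](reindex_inj (@perm_inj _ z)) /= eqxx.
by move=> /esym/forallP/(_ i).
Qed.

(** The leftmost nonzero entry of row i of the right-hand side is at (i, v' i);
    on the left-hand side a nonzero entry of column v' i lies in a row above
    v^-1 (v' i) or on it. Hence i <= v^-1 (v' i) for all i. *)
Lemma Bruhat_unique n (U V : 'M[F]_n) v t v' t' :
    unitri U -> unitri V -> U *m monomial v t = monomial v' t' *m V ->
  v = v' /\ t = t'.
Proof.
move=> uU uV E.
have EU i : val (t' i) = U i ((v^-1)%g (v' i)) * val (t ((v^-1)%g (v' i))).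
  by rewrite -(mulmx_monomial v t) permKV E mul_monomial uV // eqxx mulr1.
have vv' : (v' * v^-1)%g = 1%g.
  apply: perm_ge_id => i; rewrite permM leqNgt; apply/negP => lt.
  by have := unitF_neq0 (t' i); rewrite (EU i) uU ?(ltnW lt) // gt_eqF // mul0r eqxx.
have eqv : v = v' by rewrite -[LHS]mul1g -vv' mulgKV.
split=> //; apply/ffunP => i; apply: val_inj; have := EU i.
by rewrite eqv permK uU // eqxx mul1r.
Qed.

End Bruhat.

(** The double coset of x = n i is a translate of the product of the subgroups N
    and x N x^-1, so that its size is the square of #|N| divided by the size of
    the intersection of these two subgroups. *)
Lemma sum_double_cosets (gT : finGroupType) (N : {group gT}) (I : finType)
    (n : I -> gT) (C : numClosedFieldType) (f : gT -> C) :
    (forall g, exists i a b, [/\ a \in N, b \in N & g = a * n i * b]%g) ->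
    (forall i j a b, a \in N -> b \in N -> (a * n i = n j * b)%g -> i = j) ->
    (forall a g, a \in N -> f (a * g)%g = f g) ->
    (forall a g, a \in N -> f (g * a)%g = f g) ->
  \sum_g f g = #|N|%:R ^+ 2 *
    \sum_i #|[set u in N | (u ^ n i)%g \in N]|%:R^-1 * f (n i).
Proof.
move=> /fin_all_exists[code codeP] n_inj fl fr.
have codeE i a b : a \in N -> b \in N -> code (a * n i * b)%g = i.
  move=> Na Nb; have [a' [b' [Na' Nb' E]]] := codeP (a * n i * b)%g.
  symmetry; apply: (n_inj _ _ (a'^-1 * a)%g (b' * b^-1)%g); rewrite ?groupM ?groupV //.
  by apply: (mulgI a'); apply: (mulIg b); rewrite !mulgA mulgV mul1g mulgKV.
rewrite (partition_big code predT) //= mulr_sumr; apply: eq_bigr => i _.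
rewrite (eq_bigr (fun=> f (n i))) => [|g /eqP cg]; last first.
  by have [a [b [Na Nb ->]]] := codeP g; rewrite cg fr // fl.
have card_code : (#|[pred g | code g == i]| * #|[set u in N | (u ^ n i)%g \in N]| = #|N| ^ 2)%N.
  have -> : [set u in N | (u ^ n i)%g \in N] = N :&: (N :^ (n i)^-1)%G.
    by apply/setP => u; rewrite !inE mem_conjgV.
  have -> : (#|N| ^ 2 = #|N| * #|(N :^ (n i)^-1)%G|)%N by rewrite /= cardJg.
  rewrite mul_cardG; congr (_ * _)%N; rewrite -(card_rcoset _ (n i)).
  apply: eq_card => g; rewrite inE mem_rcoset; apply/eqP/mulsgP => [cg|[a b Na]].
    have [a [b [Na Nb gE]]] := codeP g; rewrite cg in gE.
    exists a (b ^ (n i)^-1)%g; rewrite ?memJ_conjg //.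
    by rewrite gE conjgE invgK !mulgA.
  rewrite mem_conjgV => Nb gE.
  have -> : g = (a * n i * b ^ n i)%g by rewrite -(mulgKV (n i) g) gE -!mulgA -conjgC.
  exact: codeE.
rewrite sumr_const -[LHS]mulr_natl mulrA; congr (_ * _).
rewrite -natrX -card_code natrM mulfK // pnatr_eq0 -lt0n; apply/card_gt0P; exists 1%g.
by rewrite inE conj1g group1.
Qed.

Section BruhatSum.

Variables (F : finFieldType) (C : numClosedFieldType).

Lemma card_coordinate_subspace m n (D : {set 'I_m * 'I_n}) (A0 : 'M[F]_(m, n)) :
  #|[set A : 'M[F]_(m, n) |
      [forall ij, (ij \notin D) ==> (A ij.1 ij.2 == A0 ij.1 ij.2)]]|
  = (#|F| ^ #|D|)%N.
Proof.
pose h (f : {ffun 'I_m * 'I_n -> F}) : 'M[F]_(m, n) :=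
  \matrix_(i, j) (A0 i j + f (i, j)).
have h_inj : injective h.
  move=> f1 f2 /matrixP E; apply/ffunP => -[i j].
  by have := E i j; rewrite !mxE => /addrI.
transitivity #|pffun_on (0 : F) (mem D) F|; last by rewrite card_pffun_on.
rewrite -(card_image h_inj).
apply: eq_card => A; rewrite inE; apply/forallP/imageP => [AE|[f /pffun_onP[fD _] ->] [i j]].
  exists [ffun ij => A ij.1 ij.2 - A0 ij.1 ij.2].
    apply/pffun_onP; split=> //; apply/subsetP => ij; rewrite inE ffunE /=.
    apply: contraNT => nD.
    by rewrite (eqP (implyP (AE ij) nD)) subrr.
  by apply/matrixP => i j; rewrite !mxE ffunE /= addrC subrK.
apply/implyP => nD; rewrite mxE -subr_eq0 addrC addKr /=.
by apply: contraNT nD; apply: (subsetP fD).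
Qed.

(** The positive roots which stay positive under the permutation v. *)
Definition concordant n (v : 'S_n) : {set 'I_n * 'I_n} :=
  [set ij : 'I_n * 'I_n | (ij.1 < ij.2)%N && (v ij.1 < v ij.2)%N].

(** Conjugation by a monomial matrix moves the entry at (i, j) to (v i, v j), up
    to a nonzero factor. *)
Lemma unitri_conj_monomial n (v : 'S_n) t (U U' : 'M[F]_n) :
    unitri U -> U *m monomial v t = monomial v t *m U' ->
  unitri U' <-> (forall i j : 'I_n, (i < j)%N -> (v j < v i)%N -> U i j = 0).
Proof.
move=> uU E.
have EU i j : U i j * val (t j) = val (t i) * U' (v i) (v j).
  by rewrite -(mulmx_monomial v t) E mul_monomial.
split=> [uU' i j ij vji|U0].
  apply: (mulIf (unitF_neq0 (t j))).
  by rewrite EU uU' ?(ltnW vji) // gt_eqF ?mulr0 ?mul0r.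
move=> a b; rewrite -[a](permKV v) -[b](permKV v).
move: ((v^-1)%g a) ((v^-1)%g b) => i j vji; apply: (mulfI (unitF_neq0 (t i))).
rewrite -EU (inj_eq perm_inj).
case: (ltngtP i j) => [ij|ij|/val_inj ->]; last by rewrite uU // eqxx mulrC.
  have nvij : v j != v i by rewrite (inj_eq perm_inj) gt_eqF.
  by rewrite U0 // ?ltn_neqAle ?nvij ?vji // lt_eqF // mul0r mulr0.
by rewrite uU ?(ltnW ij) // gt_eqF // mul0r mulr0.
Qed.

Variable k : nat.
Local Notation m := k.+1.
Local Notation N := (unip F m).

Definition GLmonomial (v : 'S_m) (t : {ffun 'I_m -> {unit F}}) : {'GL_m[F]} :=
  Sub (monomial v t) (monomial_unit v t).

Lemma card_unip_meet (v : 'S_m) t :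
  #|[set u in N | (u ^ GLmonomial v t)%g \in N]| = (#|F| ^ #|concordant v|)%N.
Proof.
rewrite -(card_coordinate_subspace _ 1%:M) -(card_imset _ (@val_inj _ _ {'GL_m[F]})).
have conjE (u : {'GL_m[F]}) : GLval u *m monomial v t = monomial v t *m GLval (u ^ GLmonomial v t)%g.
  have := congr1 val (conjgC u (GLmonomial v t)); exact.
apply: eq_card => A; rewrite inE; apply/imsetP/forallP => [[u]|AE].
  rewrite inE => /andP[/unipP uu /unipP uu'] -> [i j]; apply/implyP.
  rewrite inE negb_and -!leqNgt /= mxE.
  case: (leqP j i) => [ji _|ij] /=; first by rewrite uu.
  rewrite leq_eqVlt (inj_eq val_inj) (inj_eq perm_inj) gt_eqF //= => vji.
  by rewrite (proj1 (unitri_conj_monomial uu (conjE u)) uu' _ _ ij vji) lt_eqF.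
have uA : unitri A.
  move=> i j ji; have := implyP (AE (i, j)); rewrite inE /= mxE => /(_ _)/eqP; apply.
  by rewrite negb_and -leqNgt ji.
pose u : {'GL_m[F]} := Sub A (unitri_unit uA).
exists u; last by [].
rewrite inE; apply/andP; split; apply/unipP; first exact: uA.
apply: (proj2 (unitri_conj_monomial uA (conjE u))) => i j ij vji.
have := implyP (AE (i, j)); rewrite inE /= mxE lt_eqF // => /(_ _)/eqP; apply.
by rewrite negb_and -!leqNgt (ltnW vji) orbT.
Qed.

Lemma Bruhat_sum (f : 'M[F]_m -> C) :
    (forall U A, unitri U -> A \in unitmx -> f (U *m A) = f A) ->
    (forall U A, unitri U -> A \in unitmx -> f (A *m U) = f A) ->
  \sum_(g : {'GL_m[F]}) f (GLval g)
  = #|N|%:R ^+ 2 * \sum_(v : 'S_m) \sum_(t : {ffun 'I_m -> {unit F}})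
      #|F|%:R ^- #|concordant v| * f (monomial v t).
Proof.
move=> fl fr; rewrite pair_big /=.
rewrite (@sum_double_cosets _ (unip_group F m) _ (fun vt => GLmonomial vt.1 vt.2)
  C (fun g => f (GLval g))).
- by congr (_ * _); apply: eq_bigr => -[v t] _; rewrite card_unip_meet natrX.
- move=> g; have [U [V [v [t [uU uV E]]]]] := Bruhat_exists (GL_unitmx g).
  have uU' := unitri_inv uU; have uV' := unitri_inv uV.
  pose a : {'GL_m[F]} := Sub (invmx U) (unitri_unit uU').
  pose b : {'GL_m[F]} := Sub (invmx V) (unitri_unit uV').
  exists (v, t), a, b; split; try by apply/unipP.
  apply: val_inj; rewrite [RHS]/= -[RHS]/(invmx U *m monomial v t *m invmx V) -E.
  by rewrite !mulmxA mulVmx ?unitri_unit // mul1mx mulmxK ?unitri_unit.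
- move=> [v t] [v' t'] a b /unipP ua /unipP ub /(congr1 val) E.
  by have [/= -> ->] := Bruhat_unique ua ub E.
- by move=> a g /unipP ua; apply: fl => //; apply: (GL_unitmx g).
- by move=> a g /unipP ua; apply: fr => //; apply: (GL_unitmx g).
Qed.

End BruhatSum.

(** * Sums over the Shalika subgroup *)

Section ShalikaSum.

Variables (F : finFieldType) (C : numClosedFieldType) (psi : F -> C).
Hypothesis psi_char : additive_character psi.
Hypothesis psi_nontrivial : nontrivial_character psi.
Variable k : nat.
Local Notation m := k.+1.
Local Notation u := (fun X : 'M[F]_m => block_mx 1%:M X 0 1%:M : 'M[F]_(m + m)).
Local Notation dbl := (fun g : 'M[F]_m => block_mx g 0 0 g : 'M[F]_(m + m)).

(** If the coordinates j and m + j become 2j and 2j + 1, then block_mx A X L D is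
    the general upper unitriangular matrix of size 2m; its superdiagonal is made
    of the diagonal of X and of the superdiagonal of L. *)
Definition biequivariant (f : 'M[F]_(m + m) -> C) : Prop :=
  forall A X L D, unitri A -> utri X -> strict_utri L -> unitri D ->
  forall Y, let c := psi (\tr X + supdiag L) in
    f (block_mx A X L D *m Y) = c * f Y /\ f (Y *m block_mx A X L D) = c * f Y.

Lemma utri0 n : @utri F n 0.
Proof. by move=> i j _; rewrite mxE. Qed.

Lemma strict_utri0 n : @strict_utri F n 0.
Proof. by move=> i j _; rewrite mxE. Qed.

Lemma supdiag0 n : supdiag (0 : 'M[F]_n) = 0.
Proof. by rewrite /supdiag big1 // => i _; rewrite big1 // => j _; rewrite mxE. Qed.

Variable f : 'M[F]_(m + m) -> C.
Hypothesis f_bi : biequivariant f.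

Lemma biequiv_u X Y : utri X ->
  f (u X *m Y) = psi (\tr X) * f Y /\ f (Y *m u X) = psi (\tr X) * f Y.
Proof.
move=> tX; have [] := f_bi (@unitri1 F m) tX (@strict_utri0 m) (@unitri1 F m) Y.
by rewrite supdiag0 addr0.
Qed.

Lemma biequiv_diag A D Y : unitri A -> unitri D ->
  f (block_mx A 0 0 D *m Y) = f Y /\ f (Y *m block_mx A 0 0 D) = f Y.
Proof.
move=> uA uD; have [] := f_bi uA (@utri0 m) (@strict_utri0 m) uD Y.
by rewrite supdiag0 addr0 mxtrace0 (char0 psi_char) !mul1r.
Qed.

Lemma biequiv_low L Y : strict_utri L ->
  f (block_mx 1%:M 0 L 1%:M *m Y) = psi (supdiag L) * f Y /\
  f (Y *m block_mx 1%:M 0 L 1%:M) = psi (supdiag L) * f Y.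
Proof.
move=> tL; have [] := f_bi (@unitri1 F m) (@utri0 m) tL (@unitri1 F m) Y.
by rewrite mxtrace0 add0r.
Qed.

(** The term of index (g, X) in the sum of f over the Shalika subgroup against
    the inverse of its character. *)
Definition Shalika_term (g X : 'M[F]_m) : C := f (u X *m dbl g) * psi (- \tr X).

Lemma Shalika_termE g X : Shalika_term g X = f (block_mx g (X *m g) 0 g) * psi (- \tr X).
Proof. by rewrite /Shalika_term mulmx_block !mul1mx !mul0mx !mulmx0 !addr0 !add0r. Qed.

(** The character is trivial on block diagonal unitriangular matrices, and
    diag (U, U) crosses u X by conjugation. *)
Lemma Shalika_term_unitri_l U g X : unitri U ->
  Shalika_term (U *m g) X = Shalika_term g (invmx U *m X *m U).
Proof.
move=> uU; have trE : \tr (invmx U *m X *m U) = \tr X.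
  by rewrite mxtrace_mulC mulmxA mulmxV ?unitri_unit // mul1mx.
rewrite !Shalika_termE trE; congr (_ * _); rewrite -[RHS](proj1 (biequiv_diag _ uU uU)).
rewrite mulmx_block !mul0mx !mulmx0 !addr0 !add0r !mulmxA mulmxV ?unitri_unit //.
by rewrite mul1mx.
Qed.

Lemma Shalika_sum_unitri_l U g : unitri U ->
  \sum_X Shalika_term (U *m g) X = \sum_X Shalika_term g X.
Proof.
move=> uU; rewrite (eq_bigr _ (fun X _ => Shalika_term_unitri_l g X uU)).
have Um := unitri_unit uU; rewrite [RHS](reindex_inj (h := fun X => invmx U *m X *m U)) //.
move=> X Y /(congr1 (fun Z => U *m Z *m invmx U)).
by rewrite !mulmxA !mulmxV // !mul1mx !mulmxK.
Qed.

Lemma Shalika_term_unitri_r U g X : unitri U ->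
  Shalika_term (g *m U) X = Shalika_term g X.
Proof.
move=> uU; rewrite !Shalika_termE; congr (_ * _).
rewrite -[RHS](proj2 (biequiv_diag _ uU uU)).
by rewrite mulmx_block !mul0mx !mulmx0 !addr0 !add0r !mulmxA.
Qed.

Lemma Shalika_term_utri g X0 X : utri X0 ->
  Shalika_term g (X0 + X) = Shalika_term g X.
Proof.
move=> tX; rewrite !Shalika_termE raddfD opprD (charD psi_char).
have -> : block_mx g ((X0 + X) *m g) 0 g = u X0 *m block_mx g (X *m g) 0 g.
  by rewrite mulmx_block !mul1mx !mul0mx !mulmx0 !addr0 !add0r mulmxDl [_ + X0 *m g]addrC.
rewrite (proj1 (biequiv_u _ tX)) (charN psi_char (\tr X0)).
by field; apply: char_neq0 psi_char _.
Qed.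

Section MonomialTerm.

Variables (v : 'S_m) (t : {ffun 'I_m -> {unit F}}).
Local Notation n := (monomial v t).
Local Notation g := (invmx n).

Let nu : n \in unitmx := monomial_unit v t.

Definition conj_monomial (P : 'M[F]_m) := n *m P *m g.

Lemma conj_monomialE P i j : conj_monomial P i j = val (t i) * P (v i) (v j) / val (t j).
Proof.
apply: (mulIf (unitF_neq0 (t j))); rewrite divfK ?unitF_neq0 //.
by rewrite -(mulmx_monomial v t) /conj_monomial mulmxKV // mul_monomial.
Qed.

Lemma conj_monomialK P : P *m g = g *m conj_monomial P.
Proof. by rewrite /conj_monomial !mulmxA mulVmx // mul1mx. Qed.

Lemma tr_conj_monomial P : \tr (conj_monomial P) = \tr P.
Proof. by rewrite /conj_monomial mxtrace_mulC mulmxA mulVmx // mul1mx. Qed.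

Lemma Shalika_term_conj_utri X X0 : utri (conj_monomial X0) ->
  Shalika_term g (X + X0) = Shalika_term g X.
Proof.
move=> tX; rewrite !Shalika_termE raddfD opprD (charD psi_char).
have -> : block_mx g ((X + X0) *m g) 0 g = block_mx g (X *m g) 0 g *m u (conj_monomial X0).
  by rewrite mulmx_block !mulmx1 !mul0mx !mulmx0 !addr0 !add0r mulmxDl (conj_monomialK X0) [X *m g + _]addrC.
rewrite (proj2 (biequiv_u _ tX)) tr_conj_monomial (charN psi_char (\tr X0)).
by field; apply: char_neq0 psi_char _.
Qed.

(** The equivariance of f swallows a summand of X on the left of g when the
    summand is upper triangular, and on the right of g when its conjugate is. The
    places for which neither happens are the (v j, v i), for (i, j) a concordant
    pair. *)
Definition absorbed (X0 : 'M[F]_m) : Prop :=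
  forall i j : 'I_m, (i < j)%N -> (v i < v j)%N -> X0 (v j) (v i) = 0.

Lemma Shalika_term_absorbed X X0 : absorbed X0 ->
  Shalika_term g (X + X0) = Shalika_term g X.
Proof.
move=> X0P.
pose up := \matrix_(a, b) (if (a <= b)%N then X0 a b else 0) : 'M[F]_m.
pose lo := \matrix_(a, b) (if (a <= b)%N then 0 else X0 a b) : 'M[F]_m.
have -> : X + X0 = up + (X + lo).
  apply/matrixP => a b; rewrite !mxE addrCA; congr (_ + _).
  by case: ifP; rewrite ?addr0 ?add0r.
rewrite Shalika_term_utri ?Shalika_term_conj_utri // => i j ji.
  rewrite conj_monomialE mxE; case: leqP => [_|vji]; first by rewrite mulr0 mul0r.
  by rewrite X0P // mulr0 mul0r.
by rewrite mxE leqNgt ji.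
Qed.

Lemma Shalika_term_addmul X A : unitri A -> unitri (conj_monomial (invmx A)) ->
  Shalika_term g (A *m X) = f (u X *m dbl g) * psi (- \tr (A *m X)).
Proof.
move=> uA uA'; rewrite Shalika_termE; congr (_ * _).
have uAm := unitri_unit uA.
rewrite -[RHS](proj1 (biequiv_diag _ uA (@unitri1 F m))).
rewrite -[RHS](proj2 (biequiv_diag _ uA' (@unitri1 F m))); congr f.
rewrite !mulmx_block !mul1mx !mulmx1 !mul0mx !mulmx0 !addr0 !add0r !mulmxA.
by rewrite mulmxKV // mulmxV // mul1mx !mul0mx.
Qed.

(** Put a = v i and b = v j for a concordant pair (i, j) with X b a != 0. The
    matrix 1 + c E_ab crosses the argument of f at no cost, and multiplies X on
    the left: a multiple of row b is added to row a. This creates the diagonal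
    entry c X_ba. If a is as small as possible then all the rest is absorbed, so
    that the term is equal to its product by (psi (c X_ba))^-1. *)
Lemma not_absorbed_term X : ~ absorbed X -> Shalika_term g X = 0.
Proof.
move=> nX.
pose bad (ij : 'I_m * 'I_m) :=
  [&& (ij.1 < ij.2)%N, (v ij.1 < v ij.2)%N & X (v ij.2) (v ij.1) != 0].
have [ij0 bad0] : exists ij, bad ij.
  apply/existsP; apply: contra_notT nX => /existsPn good i j ij vij.
  by apply/eqP; have := good (i, j); rewrite /bad /= ij vij negbK.
case: (arg_minnP (P := bad) (fun ij => v ij.1) bad0) => -[i j].
rewrite /bad /= => /and3P[ij vij Xij] min_i {ij0 bad0}.
have [c pc] := char_scale_nontrivial psi_nontrivial Xij.
pose E c : 'M[F]_m := 1%:M + c *: delta_mx (v i) (v j).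
have EE a b c1 : E c1 a b = (a == b)%:R + c1 * ((a == v i) && (b == v j))%:R.
  by rewrite !mxE.
have uE c1 : unitri (E c1).
  move=> a b ba; rewrite EE; case: andP => [[/eqP ai /eqP bj]|_]; last by rewrite mulr0 addr0.
  by move: vij; rewrite -ai -bj ltnNge ba.
have EV : invmx (E c) = E (- c).
  have EK : E c *m E (- c) = 1%:M.
    rewrite /E mulmxDl mul1mx mulmxDr mulmx1 -scalemxAl -scalemxAr mul_delta_mx_cond.
    have -> : (v j == v i) = false by apply: contraTF vij => /eqP ->; rewrite ltnn.
    by rewrite mulr0n !scaler0 addr0 scaleNr addrNK.
  by rewrite -[LHS]mulmx1 -EK mulmxA mulVmx ?mul1mx // unitri_unit.
have uEc : unitri (conj_monomial (invmx (E c))).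
  rewrite EV => a b ba; rewrite conj_monomialE EE !(inj_eq perm_inj).
  have -> : (a == i) && (b == j) = false.
    by apply/andP => -[/eqP ai /eqP bj]; move: ij; rewrite -ai -bj ltnNge ba.
  rewrite mulr0 addr0; case: eqP => [->|_]; last by rewrite mulr0 mul0r.
  by rewrite mulr1 divff ?unitF_neq0.
pose X0 := c *: (delta_mx (v i) (v j) *m X).
have X0E a b : X0 a b = (a == v i)%:R * (c * X (v j) b).
  rewrite mxE mxE (bigD1 (v j)) //= big1 ?addr0 => [|l nl].
    by rewrite mxE eqxx andbT mulrCA.
  by rewrite mxE (negPf nl) andbF mul0r.
have EX : E c *m X = X + X0 by rewrite mulmxDl mul1mx -scalemxAl.
have tX0 : \tr X0 = c * X (v j) (v i).
  rewrite /mxtrace (bigD1 (v i)) //= big1 ?addr0 => [|l nl]; rewrite X0E ?eqxx ?mul1r //.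
  by rewrite (negPf nl) mul0r.
(* By minimality of v i, no entry of X0 on the left of its diagonal lies in a
   place that is not absorbed. *)
have aX0 : absorbed X0.
  move=> i' j' ij' vij'; rewrite X0E (inj_eq perm_inj).
  case: (j' =P i) => [ji|_]; rewrite ?mul0r // mul1r; rewrite ji in ij' vij'.
  apply/eqP; rewrite mulf_eq0; apply/orP; right; apply/negPn/negP => nX0.
  have := min_i (i', j); rewrite /= (ltn_trans ij' ij) (ltn_trans vij' vij) nX0.
  by move=> /(_ isT); rewrite leqNgt vij'.
have := Shalika_term_addmul X (uE c) uEc.
rewrite EX Shalika_term_absorbed // mxtraceD opprD (charD psi_char) mulrA.
rewrite -[f _ * _]/(Shalika_term g X) tX0 (charN psi_char).
move/eqP; rewrite -{1}[Shalika_term g X]mulr1 -subr_eq0 -mulrBr mulf_eq0.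
case/orP => [/eqP //|]; rewrite subr_eq0 eq_sym invr_eq1 => /eqP pc1.
by rewrite pc1 eqxx in pc.
Qed.

Lemma card_absorbed :
  #|[set X : 'M[F]_m | [forall ij : 'I_m * 'I_m, (ij \in concordant v) ==>
       (X (v ij.2) (v ij.1) == 0)]]| = (#|F| ^ (m * m - #|concordant v|))%N.
Proof.
pose h (ij : 'I_m * 'I_m) := (v ij.2, v ij.1).
have h_inj : injective h by move=> [a b] [c d] [/perm_inj -> /perm_inj ->].
have -> : (m * m - #|concordant v|)%N = #|~: (h @: concordant v)|.
  by rewrite [RHS]cardsCs setCK card_imset // card_prod card_ord.
rewrite -(card_coordinate_subspace _ 0); apply: eq_card => X; rewrite !inE.
apply/forallP/forallP => X0 ij; apply/implyP.
  rewrite inE negbK => /imsetP[ij' cij' ->]; rewrite mxE.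
  exact: (implyP (X0 ij')).
move=> cij; have := implyP (X0 (h ij)); rewrite inE negbK mxE; apply.
exact: imset_f.
Qed.

Lemma Shalika_sum_monomial :
  \sum_X Shalika_term g X = #|F|%:R ^+ (m * m) / #|F|%:R ^+ #|concordant v| * f (dbl g).
Proof.
have q0 : #|F|%:R != 0 :> C.
  by rewrite pnatr_eq0 -lt0n; apply/card_gt0P; exists 0.
have lec : (#|concordant v| <= m * m)%N.
  by apply: leq_trans (max_card _) _; rewrite card_prod card_ord.
rewrite -expfB_cond ?(negPf q0) //.
rewrite -natrX -card_absorbed mulr_natl -sumr_const.
rewrite [LHS](bigID (mem [set X : 'M[F]_m | [forall ij : 'I_m * 'I_m, (ij \in concordant v) ==>
       (X (v ij.2) (v ij.1) == 0)]])) /= [X in _ + X]big1 ?addr0.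
  apply: eq_bigr => X; rewrite inE => /forallP XP.
  have aX : absorbed X.
    move=> i j ij vij; apply/eqP; apply: (implyP (XP (i, j))).
    by rewrite inE /= ij.
  rewrite -[X]add0r Shalika_term_absorbed // Shalika_termE mul0mx mxtrace0 oppr0.
  by rewrite (char0 psi_char) mulr1.
move=> X nX; apply: not_absorbed_term => aX; case/negP: nX; rewrite inE.
apply/forallP => -[i j]; apply/implyP; rewrite inE /= => /andP[ij vij].
by rewrite aX.
Qed.

(** A root matrix at (v i, v j), with j = i + 1, crosses g to the place (i, j),
    where the character sees it. If v i < v j then it was upper triangular before
    the crossing as well, and the two values of the character agree for all
    parameters only if the place was on the superdiagonal and t i = t j. *)
Lemma biequiv_monomial_supp (i j : 'I_m) : f (dbl g) != 0 -> j = i.+1 :> nat ->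
  (v j < v i)%N \/ (v j = (v i).+1 :> nat /\ t i = t j).
Proof.
move=> fg ji; have nv : v i != v j.
  by rewrite (inj_eq perm_inj); apply: contra_eq_neq ji => ->; rewrite ltn_eqF.
case: (ltngtP (v i) (v j)) => [vij|vij|/val_inj vij]; [right|by left|by rewrite vij eqxx in nv].
pose L c : 'M[F]_m := c *: delta_mx (v i) (v j).
have LE c a b : L c a b = c * ((a == v i) && (b == v j))%:R by rewrite !mxE.
have supdiag_delta c (a b : 'I_m) : supdiag (c *: delta_mx a b) = c * (b == a.+1 :> nat)%:R.
  rewrite /supdiag (bigD1 a) //= [X in _ + X]big1 ?addr0 => [|l nl]; last first.
    by rewrite big1 // => l' _; rewrite !mxE (negPf nl) mulr0.
  rewrite big_mkcond (bigD1 b) //= big1 ?addr0 => [|l nl]; last first.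
    by rewrite !mxE (negPf nl) andbF mulr0 if_same.
  by rewrite !mxE !eqxx; case: eqP; rewrite ?mulr0.
have conjL c : conj_monomial (L c) = (c * val (t i) / val (t j)) *: delta_mx i j.
  apply/matrixP => a b; rewrite conj_monomialE LE !(inj_eq perm_inj) !mxE.
  case: (a =P i) => [->|_] /=; last by rewrite !mulr0 mul0r.
  by case: (b =P j) => [->|_] /=; rewrite ?mulr0 ?mul0r //; ring.
have strictL c : strict_utri (L c).
  move=> a b ba; rewrite LE; case: andP => [[/eqP ai /eqP bj]|_]; last by rewrite mulr0.
  by move: vij; rewrite -ai -bj ltnNge ba.
have strictL' c : strict_utri (conj_monomial (L c)).
  move=> a b ba; rewrite conjL !mxE; case: andP => [[/eqP ai /eqP bj]|_]; last by rewrite mulr0.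
  by move: ba; rewrite ai bj ji ltnn.
have key c : psi (c * ((v j == (v i).+1 :> nat)%:R - val (t i) / val (t j))) = 1.
  apply/eqP; have E : block_mx 1%:M 0 (L c) 1%:M *m dbl g
      = dbl g *m block_mx 1%:M 0 (conj_monomial (L c)) 1%:M.
    by rewrite !mulmx_block !mul1mx !mulmx1 !mul0mx !mulmx0 !addr0 !add0r conj_monomialK.
  have := proj1 (biequiv_low (dbl g) (strictL c)).
  rewrite E (proj2 (biequiv_low (dbl g) (strictL' c))) => /(mulIf fg).
  rewrite conjL !supdiag_delta ji eqxx mulr1 => psiE.
  rewrite mulrBr (charD psi_char) (charN psi_char) -psiE mulrA divff //.
  exact: char_neq0.
have {key} : (v j == (v i).+1 :> nat)%:R - val (t i) / val (t j) == 0.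
  apply/eqP/eqP; apply: contraT => /(char_scale_nontrivial psi_nontrivial)[c].
  by rewrite key eqxx.
case: (@eqP nat) => [vE|_]; last by rewrite /= sub0r oppr_eq0 mulf_eq0 invr_eq0 !(negPf (unitF_neq0 _)).
rewrite subr_eq0 => /eqP E; split=> //; apply: val_inj.
by rewrite -[LHS](divfK (unitF_neq0 (t j))) -E mul1r.
Qed.

End MonomialTerm.

(** One factor q^(- #|concordant v|) comes from the size of the double coset and
    the other one from the number of absorbed X. The sum runs over g^-1, because
    the representative in play is the inverse of a monomial matrix. *)
Lemma Shalika_sum :
  \sum_(h : {'GL_m[F]}) \sum_X Shalika_term (GLval h) X
  = #|unip F m|%:R ^+ 2 * #|F|%:R ^+ (m * m)
    * \sum_(v : 'S_m) \sum_(t : {ffun 'I_m -> {unit F}})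
        #|F|%:R ^- (2 * #|concordant v|) * f (dbl (invmx (monomial v t))).
Proof.
rewrite (reindex_inj invg_inj) /=.
pose T A := if A \in unitmx then \sum_X Shalika_term (invmx A) X else 0.
have invmxM (A B : 'M[F]_m) : A \in unitmx -> B \in unitmx -> invmx (A *m B) = invmx B *m invmx A.
  exact: invrM.
rewrite (eq_bigr (fun h : {'GL_m[F]} => T (GLval h))); last first.
  by move=> h _; rewrite /T (GL_unitmx h : GLval h \in unitmx).
rewrite Bruhat_sum => [|U A uU uA|U A uU uA].
- rewrite -mulrA; congr (_ * _); rewrite mulr_sumr; apply: eq_bigr => v _.
  rewrite mulr_sumr; apply: eq_bigr => t _; rewrite /T monomial_unit Shalika_sum_monomial.
  by rewrite mul2n -addnn exprD invfM; ring.
- have uU' := unitri_unit uU; rewrite /T unitmx_mul uU' uA /= invmxM //.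
  by apply: eq_bigr => X _; rewrite Shalika_term_unitri_r //; apply: unitri_inv.
- have uU' := unitri_unit uU; rewrite /T unitmx_mul uU' uA /= invmxM //.
  by rewrite Shalika_sum_unitri_l //; apply: unitri_inv.
Qed.

End ShalikaSum.

(** * Block antidiagonal monomial matrices and labelled compositions *)

Section Compositions.

Local Open Scope nat_scope.

Variable F : finFieldType.
Implicit Type l : seq (nat * {unit F}).

Definition block_total l : nat := \sum_(x <- l) x.1.

(** A list of pairs (p, x) stands for the block antidiagonal matrix with blocks
    x I_p, the head of the list being the top right block: block_col l i is the
    column of the nonzero entry of row i, and block_scal l i is this entry. *)
Fixpoint block_col l (i : nat) : nat :=
  if l is x :: l' then if (i < x.1)%N then (block_total l' + i)%N else block_col l' (i - x.1) else 0.

Fixpoint block_scal l (i : nat) : {unit F} :=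
  if l is x :: l' then if (i < x.1)%N then x.2 else block_scal l' (i - x.1) else 1%g.

Lemma block_total_cons x l : block_total (x :: l) = (x.1 + block_total l)%N.
Proof. by rewrite /block_total big_cons. Qed.

Lemma block_col_lt l i : (i < block_total l)%N -> (block_col l i < block_total l)%N.
Proof.
elim: l i => [|x l IHl] i; first by rewrite /block_total big_nil.
rewrite block_total_cons /=; case: (ltnP i x.1) => [ix _|xi]; first by lia.
by rewrite -ltn_subLR // => /IHl lt; apply: ltn_addl.
Qed.

Lemma block_col_inj l i j : (i < block_total l)%N -> (j < block_total l)%N ->
  block_col l i = block_col l j -> i = j.
Proof.
elim: l i j => [|x l IHl] i j; first by rewrite /block_total big_nil.
rewrite block_total_cons /=; have [ix|xi] := ltnP i x.1; have [jx|xj] := ltnP j x.1 => il jl.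
- exact: addnI.
- have := @block_col_lt l (j - x.1); lia.
- have := @block_col_lt l (i - x.1); lia.
by move=> /IHl; lia.
Qed.

(** The first row already gives the first block: its column is the total size of
    the other blocks. *)
Lemma composition_inj l l' :
    all (fun x => 0 < x.1)%N l -> all (fun x => 0 < x.1)%N l' -> block_total l = block_total l' ->
    (forall i, (i < block_total l)%N ->
      block_col l i = block_col l' i /\ block_scal l i = block_scal l' i) ->
  l = l'.
Proof.
elim: l l' => [|x l IHl] [|y l'] //=; rewrite ?block_total_cons.
- by rewrite /block_total big_nil => _ /andP[y0 _]; lia.
- by rewrite /block_total big_nil => /andP[y0 _]; lia.
case/andP=> x0 pl /andP[y0 pl'] E H; have [] := H 0 ltac:(lia).
rewrite x0 y0 => Et Es; have xy : x.1 = y.1 by lia.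
congr (_ :: _); first by rewrite [x]surjective_pairing xy Es -surjective_pairing.
apply: IHl => // [|i il]; first by lia.
have := H (x.1 + i)%N ltac:(lia).
by rewrite -xy addKn (_ : (x.1 + i < x.1)%N = false) //; lia.
Qed.

Lemma leq_of_inj (f : nat -> nat) n p :
    (forall i, (i < n)%N -> (f i < p)%N) ->
    (forall i j, (i < n)%N -> (j < n)%N -> f i = f j -> i = j) -> (n <= p)%N.
Proof.
move=> fp f_inj; rewrite -(size_iota 0 n) -(size_map f) -(size_iota 0 p).
apply: uniq_leq_size => [|y /mapP[i]]; last by rewrite !mem_iota /= add0n => /fp fi ->.
by rewrite map_inj_in_uniq ?iota_uniq // => i j; rewrite !mem_iota /=; apply: f_inj.
Qed.

(** The first block of l is the first maximal run of consecutive values of a;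
    injectivity forces all later values below that run, so the run is on top. *)
Lemma composition_exists M (a : nat -> nat) (b : nat -> {unit F}) :
    (forall i, (i < M)%N -> (a i < M)%N) ->
    (forall i j, (i < M)%N -> (j < M)%N -> a i = a j -> i = j) ->
    (forall i, (i.+1 < M)%N -> (a i.+1 < a i)%N \/ (a i.+1 = (a i).+1 /\ b i = b i.+1)) ->
  exists l, [/\ all (fun x => 0 < x.1)%N l, block_total l = M &
    forall i, (i < M)%N -> a i = block_col l i /\ b i = block_scal l i].
Proof.
have [N] := ubnP M; elim: N M a b => // N IHN M a b leM aM a_inj step.
have [M0|M0] := posnP M.
  by exists [::]; split=> // [|i]; rewrite ?M0 // /block_total big_nil.
pose P p := (0 < p)%N && ((p == M) || (a p < a p.-1)%N).
have exP : exists p, P p by exists M; rewrite /P M0 eqxx.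
case: (ex_minnP exP) => p /andP[p0 Pp] min_p.
have leM_p : (p <= M)%N by apply: min_p; rewrite /P M0 eqxx.
have run i : (i < p)%N -> a i = (a 0 + i)%N /\ b i = b 0.
  elim: i => [|i IHi] ip; first by rewrite addn0.
  have [ai bi] := IHi (ltnW ip); case: (step i) => [|lt|[aS bS]]; first by lia.
    have := min_p i.+1; rewrite /P /= lt orbT => /(_ isT); lia.
  by rewrite aS ai -bS bi addnS.
have below i : (p <= i)%N -> (i < M)%N -> (a i < a 0)%N.
  elim: i => [|i IHi]; first by lia.
  rewrite leq_eqVlt => /orP[/eqP pi|pi] iM.
    have [ai _] := run i ltac:(lia).
    case: (ltnP (a i.+1) (a 0)) => // le.
    move: Pp; rewrite pi => /orP[/eqP|/= lt]; first by lia.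
    have ltp : (a i.+1 - a 0 < p)%N by lia.
    have [aj _] := run (a i.+1 - a 0)%N ltp.
    have := a_inj (a i.+1 - a 0)%N i.+1; lia.
  have lt := IHi pi (ltnW iM); case: (step i iM) => [|[aS _]]; first by lia.
  have := a_inj i.+1 0 iM M0; lia.
have a0 : a 0 = (M - p)%N.
  have le : (M - p <= a 0)%N.
    apply: (@leq_of_inj (fun i => a (p + i)%N)) => [i ip|i j ip jp E].
      by apply: below; lia.
    by apply/(@addnI p)/a_inj => //; lia.
  have [ap _] := run p.-1 ltac:(lia); have := aM p.-1 ltac:(lia); lia.
have [] := IHN (M - p)%N (fun i => a (p + i)%N) (fun i => b (p + i)%N).
- by lia.
- by move=> i ip; rewrite -a0; apply: below; lia.
- by move=> i j ip jp E; apply/(@addnI p)/a_inj => //; lia.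
- by move=> i ip; rewrite addnS; apply: step; lia.
move=> l [pl tl lP]; exists ((p, b 0) :: l); split.
- by rewrite /= p0.
- by rewrite block_total_cons tl /=; lia.
move=> i iM /=; case: ltnP => ip; first by have [-> ->] := run i ip; rewrite tl a0.
by have := lP (i - p)%N ltac:(lia); rewrite subnKC.
Qed.

Lemma sum_ltn_ord p : (\sum_(i < p) \sum_(j < p) (i < j) = 'C(p, 2))%N.
Proof.
rewrite exchange_big -bin2_sum big_mkord /=; apply: eq_bigr => j _.
by rewrite -big_mkcond -(big_ord_widen p (fun=> 1%N) (ltnW (ltn_ord j))) sum1_card card_ord.
Qed.

(** Rows in different blocks have their entries in the reversed order, so that
    only the pairs of rows inside a block count. *)
Lemma count_concordant l :
  (\sum_(i < block_total l) \sum_(j < block_total l) ((i < j) && (block_col l i < block_col l j))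
   = \sum_(x <- l) 'C(x.1, 2))%N.
Proof.
elim: l => [|x l IHl]; first by rewrite /block_total !big_nil big_ord0.
rewrite block_total_cons big_cons -IHl -sum_ltn_ord big_split_ord /=; congr (_ + _)%N.
  apply: eq_bigr => i _; rewrite big_split_ord /= [X in (_ + X)%N]big1 ?addn0 => [|j _].
    by apply: eq_bigr => j _; rewrite !ltn_ord ltn_add2l andbb.
  rewrite ltn_ord ifF ?addKn; last by lia.
  by have := block_col_lt (ltn_ord j); lia.
apply: eq_bigr => i _; rewrite big_split_ord /= [X in (X + _)%N]big1 ?add0n => [|j _].
  apply: eq_bigr => j _; rewrite ltn_add2l !ifF ?addKn //; lia.
by have := ltn_ord j; lia.
Qed.

End Compositions.

Section Realization.

Variables (F : finFieldType) (k : nat).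
Local Notation m := k.+1.
Implicit Types (l : seq (nat * {unit F})) (v : 'S_m) (t : {ffun 'I_m -> {unit F}}).

Definition composition l : Prop := all (fun x => 0 < x.1)%N l /\ block_total l = m.

Definition realizes l v t : bool :=
  [forall i, (v i == block_col l i :> nat) && (t i == block_scal l i)].

Lemma realizesP l v t :
  reflect (forall i, v i = block_col l i :> nat /\ t i = block_scal l i) (realizes l v t).
Proof.
apply: (iffP forallP) => H i; first by have /andP[/eqP-> /eqP->] := H i.
by have [-> ->] := H i; rewrite !eqxx.
Qed.

Lemma realizes_exists l : block_total l = m -> exists v t, realizes l v t.
Proof.
move=> tl; pose a (i : 'I_m) : 'I_m := inord (block_col l i).
have aE (i : 'I_m) : a i = block_col l i :> nat.
  by rewrite inordK // -[X in (_ < X)%N]tl block_col_lt // tl.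
have a_inj : injective a.
  move=> i j /(congr1 val) /=; rewrite !aE => E; apply/val_inj/(block_col_inj _ _ E); rewrite tl //.
exists (perm a_inj), [ffun i => block_scal l (i : 'I_m)]; apply/realizesP => i.
by rewrite permE aE ffunE.
Qed.

Lemma realizes_inj l v t v' t' : realizes l v t -> realizes l v' t' -> v = v' /\ t = t'.
Proof.
move=> /realizesP H /realizesP H'; split.
  by apply/permP => i; apply: val_inj; rewrite /= (H i).1 (H' i).1.
by apply/ffunP => i; rewrite (H i).2 (H' i).2.
Qed.

Lemma realizes_list_inj l l' v t :
  composition l -> composition l' -> realizes l v t -> realizes l' v t -> l = l'.
Proof.
move=> [pl tl] [pl' tl'] /realizesP H /realizesP H'.
apply: composition_inj => //; rewrite tl ?tl' // => i im.
by have [<- <-] := H (Ordinal im); have [<- <-] := H' (Ordinal im).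
Qed.

Lemma special_realized v t :
    (forall i j : 'I_m, j = i.+1 :> nat ->
      (v j < v i)%N \/ (v j = (v i).+1 :> nat /\ t i = t j)) ->
  exists2 l, composition l & realizes l v t.
Proof.
move=> special.
have [|i j im jm /val_inj/perm_inj/(congr1 val)|i im|l [pl tl H]] :=
    @composition_exists F m (fun i => v (inord i)) (fun i => t (inord i)).
- by move=> i _; apply: ltn_ord.
- by rewrite /= !inordK.
- by apply: special; rewrite !inordK // ltnW.
by exists l => //; apply/realizesP => i; have := H i (ltn_ord i); rewrite inord_val.
Qed.

Lemma card_concordant l v t : block_total l = m -> realizes l v t ->
  #|concordant v| = (\sum_(x <- l) 'C(x.1, 2))%N.
Proof.
move=> tl /realizesP H; rewrite -count_concordant tl pair_big /= -sum1_card big_mkcond /=.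
apply: eq_bigr => -[i j] _ /=; rewrite inE /= (H i).1 (H j).1.
by case: ifP.
Qed.

Definition block_list r (mu : {ffun 'I_r -> 'I_k.+2}) (lam : {ffun 'I_r -> {unit F}}) :=
  [seq (mu i : nat, lam i) | i <- enum 'I_r].

Lemma sum_block_list (T : nmodType) (G : nat * {unit F} -> T) r
    (mu : {ffun 'I_r -> 'I_k.+2}) (lam : {ffun 'I_r -> {unit F}}) :
  \sum_(x <- @block_list r mu lam) G x = \sum_i G (mu i : nat, lam i).
Proof. by rewrite big_map big_enum. Qed.

Lemma block_list_composition r (mu : {ffun 'I_r -> 'I_k.+2}) (lam : {ffun 'I_r -> {unit F}}) :
  [forall i, (0 < mu i)%N] && (\sum_i mu i == m)%N -> composition (@block_list r mu lam).
Proof.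
case/andP => /forallP pos /eqP sum; split; last by rewrite /block_total big_map big_enum.
by rewrite all_map; apply/allP => i _; apply: pos.
Qed.

Lemma block_list_inj r (mu mu' : {ffun 'I_r -> 'I_k.+2}) (lam lam' : {ffun 'I_r -> {unit F}}) :
  @block_list r mu lam = block_list mu' lam' -> mu = mu' /\ lam = lam'.
Proof.
move/eq_in_map => E; split; apply/ffunP => i; have [] := E i (mem_enum _ _) => //.
by move=> /val_inj.
Qed.

Lemma composition_block_list l : composition l ->
  [/\ (1 <= size l < k.+2)%N &
    exists (mu : {ffun 'I_(size l) -> 'I_k.+2}) (lam : {ffun 'I_(size l) -> {unit F}}),
      [forall i, (0 < mu i)%N] && (\sum_i mu i == m)%N /\ block_list mu lam = l].
Proof.
move=> [pl tl].
have le_sum (s : seq (nat * {unit F})) : all (fun x => 0 < x.1)%N s -> (size s <= block_total s)%N.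
  by elim: s => // x s IHs /= /andP[x0 /IHs]; rewrite block_total_cons; lia.
have le1 x : x \in l -> (x.1 <= m)%N.
  by rewrite -tl /block_total => xl; rewrite (big_rem x) //= leq_addr.
split.
  have := le_sum l pl; rewrite tl ltnS => ->; rewrite andbT.
  by case: (l) tl => //; rewrite /block_total big_nil.
pose x0 : nat * {unit F} := (0%N, 1%g).
pose mu : {ffun 'I_(size l) -> 'I_k.+2} := [ffun i : 'I__ => inord (nth x0 l i).1].
pose lam : {ffun 'I_(size l) -> {unit F}} := [ffun i : 'I__ => (nth x0 l i).2].
have E : block_list mu lam = l.
  apply: (@eq_from_nth _ x0) => [|i]; rewrite size_map size_enum_ord // => il.
  rewrite (nth_map (Ordinal il)) ?size_enum_ord // !ffunE !nth_enum_ord //.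
  by rewrite inordK ?ltnS ?le1 ?mem_nth // -surjective_pairing.
exists mu, lam; split=> //; apply/andP; split; last first.
  by apply/eqP; have := tl; rewrite -{1}E /block_total sum_block_list.
apply/forallP => i; rewrite ffunE inordK ?ltnS ?le1 ?mem_nth //.
exact: (allP pl) (mem_nth _ _).
Qed.

Variable C : numClosedFieldType.

Lemma sum_indicator (T : finType) (P : pred T) (c : T -> C) x0 : P x0 ->
  (forall x, P x -> x != x0 -> c x = 0) -> \sum_(x | P x) c x = c x0.
Proof. by move=> Px H; rewrite (bigD1 x0) //= big1 ?addr0 // => x /andP[]; apply: H. Qed.

Lemma sum_compositions_delta l0 : composition l0 ->
  \sum_(1 <= r < k.+2)
    \sum_(mu : {ffun 'I_r -> 'I_k.+2} | [forall i, (0 < mu i)%N] && (\sum_i mu i == m)%N)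
      \sum_(lam : {ffun 'I_r -> {unit F}}) (block_list mu lam == l0)%:R = 1 :> C.
Proof.
move=> cl; have [sl [mu [lam [mu_ok E]]]] := composition_block_list cl.
rewrite (bigD1_seq (size l0)) ?iota_uniq ?mem_index_iota //= [X in _ + X]big1 ?addr0; last first.
  move=> r nr; rewrite big1 // => mu' _; rewrite big1 // => lam' _.
  by case: (block_list _ _ =P l0) nr => // <-; rewrite size_map size_enum_ord eqxx.
rewrite (@sum_indicator _ _ _ mu) // => [|mu' _ nmu]; last first.
  rewrite big1 // => lam' _; case: eqP => // E'.
  by have [mumu' _] := block_list_inj (etrans E' (esym E)); rewrite mumu' eqxx in nmu.
rewrite (@sum_indicator _ _ _ lam) ?E ?eqxx // => lam' _ nlam; case: eqP => // E'.
by have [_ ll] := block_list_inj (etrans E' (esym E)); rewrite ll eqxx in nlam.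
Qed.

(** Each pair (v, t) carrying a nonzero term is realized by exactly one
    labelled composition, and each labelled composition realizes one pair. *)
Lemma sum_monomial_compositions (H : 'S_m -> {ffun 'I_m -> {unit F}} -> C)
    (G : seq (nat * {unit F}) -> C) :
    (forall v t, H v t != 0 -> exists2 l, composition l & realizes l v t) ->
    (forall v t l, composition l -> realizes l v t -> H v t = G l) ->
  \sum_v \sum_t H v t =
  \sum_(1 <= r < k.+2)
    \sum_(mu : {ffun 'I_r -> 'I_k.+2} | [forall i, (0 < mu i)%N] && (\sum_i mu i == m)%N)
      \sum_(lam : {ffun 'I_r -> {unit F}}) G (block_list mu lam).
Proof.
move=> Hsupp HG.
pose S r (mu : {ffun 'I_r -> 'I_k.+2}) (lam : {ffun 'I_r -> {unit F}}) v t :=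
  (realizes (block_list mu lam) v t)%:R * H v t.
transitivity (\sum_v \sum_t \sum_(1 <= r < k.+2)
    \sum_(mu : {ffun 'I_r -> 'I_k.+2} | [forall i, (0 < mu i)%N] && (\sum_i mu i == m)%N)
      \sum_(lam : {ffun 'I_r -> {unit F}}) S r mu lam v t).
  apply: eq_bigr => v _; apply: eq_bigr => t _.
  have [H0|/Hsupp[l0 cl0 rl0]] := eqVneq (H v t) 0.
    rewrite H0; symmetry; rewrite big1 // => r _; rewrite big1 // => mu _.
    by rewrite big1 // => lam _; rewrite /S H0 mulr0.
  rewrite -[LHS]mul1r -(sum_compositions_delta cl0) mulr_suml; apply: eq_bigr => r _.
  rewrite mulr_suml; apply: eq_bigr => mu mu_ok.
  rewrite mulr_suml; apply: eq_bigr => lam _; congr (_%:R * _).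
  have cl := block_list_composition lam mu_ok.
  case: eqP => [->|nl]; first by rewrite rl0.
  by case: (boolP (realizes _ _ _)) => // rl; case: nl; apply: realizes_list_inj rl0.
rewrite pair_big /= exchange_big /=; apply: eq_bigr => r _.
rewrite exchange_big /=; apply: eq_bigr => mu mu_ok.
rewrite exchange_big /=; apply: eq_bigr => lam _.
have cl := block_list_composition lam mu_ok.
have [v [t rvt]] := realizes_exists cl.2.
rewrite (@sum_indicator _ _ _ (v, t)) /S //= ?rvt ?mul1r ?(HG v t _ cl rvt) // => -[v' t'] _ /=.
case: (boolP (realizes _ v' t')) => [r'|]; rewrite ?mul0r //.
by have [-> ->] := realizes_inj rvt r'; rewrite eqxx.
Qed.

End Realization.

(** * Interleaved coordinates *)

Section Placement.

Variable F : finFieldType.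

(** The basis vector of index j is put at place a j. *)
Definition place_mx n (a : 'I_n -> 'I_n) : 'M[F]_n := \matrix_(i, j) (i == a j)%:R.

Lemma place_mul n (a b : 'I_n -> 'I_n) : place_mx a *m place_mx b = place_mx (a \o b).
Proof.
apply/matrixP => i j; rewrite !mxE (bigD1 (b j)) //= big1 ?addr0 => [|l nl].
  by rewrite !mxE eqxx mulr1.
by rewrite !mxE (negPf nl) mulr0.
Qed.

Section Injective.

Variables (n : nat) (a : 'I_n -> 'I_n).
Hypothesis a_inj : injective a.

Lemma place_trK : (place_mx a)^T *m place_mx a = 1%:M.
Proof.
apply/matrixP => i j; rewrite !mxE (bigD1 (a j)) //= big1 ?addr0 => [|l nl].
  by rewrite !mxE eqxx mulr1 (inj_eq a_inj) eq_sym.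
by rewrite !mxE (negPf nl) mulr0.
Qed.

Lemma place_Ktr : place_mx a *m (place_mx a)^T = 1%:M.
Proof. exact: mulmx1C place_trK. Qed.

Lemma place_unit : place_mx a \in unitmx.
Proof. by case/mulmx1_unit: place_Ktr. Qed.

Lemma place_mulE (A : 'M[F]_n) i j : (place_mx a *m A) (a i) j = A i j.
Proof.
rewrite mxE (bigD1 i) //= big1 ?addr0 => [|l nl]; first by rewrite mxE eqxx mul1r.
by rewrite mxE (inj_eq a_inj) eq_sym (negPf nl) mul0r.
Qed.

Lemma mul_placeE (A : 'M[F]_n) i j : (A *m (place_mx a)^T) i (a j) = A i j.
Proof.
rewrite mxE (bigD1 j) //= big1 ?addr0 => [|l nl]; first by rewrite !mxE eqxx mulr1.
by rewrite !mxE (inj_eq a_inj) eq_sym (negPf nl) mulr0.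
Qed.

Definition placed_unitri (V : 'M[F]_n) : Prop :=
  forall i j : 'I_n, (a j <= a i)%N -> V i j = (i == j)%:R.

Definition placed_supdiag (V : 'M[F]_n) : F :=
  \sum_(i < n) \sum_(j < n | a j == (a i).+1 :> nat) V i j.

Lemma placed_conj V : placed_unitri V ->
  unitri (place_mx a *m V *m (place_mx a)^T) /\
  supdiag (place_mx a *m V *m (place_mx a)^T) = placed_supdiag V.
Proof.
have E i j : (place_mx a *m V *m (place_mx a)^T) (a i) (a j) = V i j.
  by rewrite mul_placeE place_mulE.
move=> uV; split=> [i j|].
  have /codomP[i' ->] : i \in codom a by apply: inj_card_onto.
  have /codomP[j' ->] : j \in codom a by apply: inj_card_onto.
  by rewrite E (inj_eq a_inj); apply: uV.
rewrite /supdiag (reindex_inj a_inj); apply: eq_bigr => i _.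
by rewrite (reindex_inj a_inj); apply: eq_bigr => j _; rewrite E.
Qed.

End Injective.
End Placement.

Section BesselFunction.

Variables (F : finFieldType) (C : numClosedFieldType) (psi : F -> C).
Hypothesis psi_char : additive_character psi.
Variable k : nat.
Local Notation m := k.+1.
Local Notation n := (k.+1 + k.+1 + 1)%N.
Variable B : {'GL_n[F]} -> C.
Hypothesis B_bi : forall g u1 u2, u1 \in unip F n -> u2 \in unip F n ->
  B (u1 * g * u2)%g = psi_unip psi u1 * psi_unip psi u2 * B g.

(** The extension by 0 makes the equivariance hold for all matrices, with no
    invertibility to check. *)
Definition Bessel_mx (A : 'M[F]_n) : C := if A \in unitmx then B (@toGL F n A) else 0.

Lemma Bessel_mx_unitri (U1 U2 A : 'M[F]_n) : unitri U1 -> unitri U2 ->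
  Bessel_mx (U1 *m A *m U2) = psi (supdiag U1) * psi (supdiag U2) * Bessel_mx A.
Proof.
move=> u1 u2; rewrite /Bessel_mx.
have U1u : U1 \in unitmx by apply: unitri_unit.
have U2u : U2 \in unitmx by apply: unitri_unit.
rewrite !unitmx_mul U1u U2u andbT /=; case: ifP => uA; last by rewrite mulr0.
have mem U : unitri U -> (@toGL F n U : {'GL_n[F]}) \in unip F n.
  by move=> uU; apply/unipP; rewrite toGLK //; apply: unitri_unit.
have psiE U : unitri U -> psi_unip psi (@toGL F n U) = psi (supdiag U).
  by move=> uU; rewrite /psi_unip toGLK //; apply: unitri_unit.
have uU1A : U1 *m A \in unitmx by rewrite unitmx_mul U1u.
have -> : @toGL F n (U1 *m A *m U2) = (@toGL F n U1 * @toGL F n A * @toGL F n U2)%g.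
  by rewrite -(@toGL_mul F n U1 A) // -(@toGL_mul F n (U1 *m A) U2).
by rewrite B_bi ?mem // !psiE.
Qed.

Lemma Bessel_mx_placed_l a (V Y : 'M[F]_n) : injective a -> placed_unitri a V ->
  Bessel_mx (place_mx F a *m V *m Y) = psi (placed_supdiag a V) * Bessel_mx (place_mx F a *m Y).
Proof.
move=> a_inj /(placed_conj a_inj)[uV <-].
have -> : place_mx F a *m V *m Y =
    place_mx F a *m V *m (place_mx F a)^T *m (place_mx F a *m Y) *m 1%:M.
  by rewrite mulmx1 -!mulmxA; do 2!congr (_ *m _); rewrite mulmxA place_trK // mul1mx.
rewrite Bessel_mx_unitri //; last exact: unitri1.
by rewrite supdiag1 (char0 psi_char) mulr1.
Qed.

Lemma Bessel_mx_placed_r a (V Y : 'M[F]_n) : injective a -> placed_unitri a V ->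
  Bessel_mx (Y *m V *m (place_mx F a)^T) = psi (placed_supdiag a V) * Bessel_mx (Y *m (place_mx F a)^T).
Proof.
move=> a_inj /(placed_conj a_inj)[uV <-].
have -> : Y *m V *m (place_mx F a)^T =
    1%:M *m (Y *m (place_mx F a)^T) *m (place_mx F a *m V *m (place_mx F a)^T).
  rewrite mul1mx !mulmxA; do 2!congr (_ *m _).
  by rewrite -mulmxA place_trK // mulmx1.
rewrite Bessel_mx_unitri //; last exact: unitri1.
by rewrite supdiag1 (char0 psi_char) mul1r.
Qed.

Lemma sigma_lt (i : 'I_n) : (sigma k i < n)%N.
Proof. by have := ltn_ord i; rewrite /sigma; case: ifP; last case: ifP; lia. Qed.

Definition interleave (i : 'I_n) : 'I_n := Ordinal (sigma_lt i).

Lemma interleave1_lt (i : 'I_n) : ((if (i < m + m)%N then (sigma k i).+1 else 0) < n)%N.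
Proof. by have := ltn_ord i; rewrite /sigma; case: ifP; last by []; case: ifP; last case: ifP; lia. Qed.

(** The places of the coordinates in antidiag (1, Y): the last coordinate comes
    first, and the others are shifted by one. *)
Definition interleave1 (i : 'I_n) : 'I_n := Ordinal (interleave1_lt i).

Lemma interleave_inj : injective interleave.
Proof.
move=> i j /(congr1 val); have := ltn_ord i; have := ltn_ord j.
rewrite /= /sigma => jn iN E; apply: val_inj => /=.
by move: E; repeat (case: ifP => ?); lia.
Qed.

Lemma interleave1_inj : injective interleave1.
Proof.
move=> i j /(congr1 val); have := ltn_ord i; have := ltn_ord j.
rewrite /= /sigma => jn iN E; apply: val_inj => /=.
by move: E; repeat (case: ifP => ?); lia.
Qed.

Definition ext1 (Y : 'M[F]_(m + m)) : 'M[F]_n := block_mx Y 0 0 1%:M.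

Lemma ext1_mul Y1 Y2 : ext1 (Y1 *m Y2) = ext1 Y1 *m ext1 Y2.
Proof. by rewrite /ext1 mulmx_block !mulmx0 !mul0mx !addr0 !add0r mulmx1. Qed.

Lemma ext1_1 : ext1 1%:M = 1%:M.
Proof. by rewrite /ext1 -scalar_mx_block. Qed.

(** Up to the interleaving of coordinates this is B (diag (Y, 1)) when a is
    interleave, and B (antidiag (1, Y)) when a is interleave1. *)
Definition placed_Bessel a (Y : 'M[F]_(m + m)) : C :=
  Bessel_mx (place_mx F a *m ext1 Y *m (place_mx F interleave)^T).

Definition shifts_sigma (a : 'I_n -> 'I_n) (e : nat) : Prop :=
  forall i : 'I_(m + m), a (lshift 1 i) = (sigma k i + e)%N :> nat.

Lemma sigma_l (i : 'I_m) : sigma k (lshift m i) = i.*2.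
Proof. by rewrite /sigma /= ltn_ord. Qed.

Lemma sigma_r (i : 'I_m) : sigma k (rshift m i) = i.*2.+1.
Proof. by have := ltn_ord i; rewrite /sigma /=; repeat (case: ifP => ?); lia. Qed.

Lemma placed_block a e A X L D : shifts_sigma a e ->
    unitri A -> utri X -> strict_utri L -> unitri D ->
  placed_unitri a (ext1 (block_mx A X L D)) /\
  placed_supdiag a (ext1 (block_mx A X L D)) = \tr X + supdiag L.
Proof.
move=> ae uA tX tL uD; split=> [i j|].
  case: (split_ordP i) => {}i ->; case: (split_ordP j) => {}j ->; rewrite /ext1.
  - rewrite block_mxEul !ae leq_add2r (inj_eq (@lshift_inj _ _)).
    case: (split_ordP i) => {}i ->; case: (split_ordP j) => {}j ->; rewrite ?sigma_l ?sigma_r.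
    + by rewrite block_mxEul leq_double (inj_eq (@lshift_inj _ _)); apply: uA.
    + by rewrite block_mxEur eq_lrshift => ji; apply: tX; lia.
    + by rewrite block_mxEdl eq_rlshift => ji; apply: tL; lia.
    + by rewrite block_mxEdr ltnS leq_double (inj_eq (@rshift_inj _ _)); apply: uD.
  - by rewrite block_mxEur mxE eq_lrshift.
  - by rewrite block_mxEdl mxE eq_rlshift.
  - by rewrite block_mxEdr mxE (inj_eq (@rshift_inj _ _)).
rewrite /placed_supdiag big_split_ord /= [X in _ + X]big1 ?addr0; last first.
  move=> i _; rewrite big_mkcond big_split_ord /= !big1 ?addr0 // => j _.
    by rewrite !ord1; case: eqP => //; lia.
  by rewrite /ext1 block_mxEdl mxE if_same.
have E (i : 'I_(m + m)) : \sum_(j < n | a j == (a (lshift 1 i)).+1 :> nat) ext1 (block_mx A X L D) (lshift 1 i) j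
    = \sum_(j < m + m | sigma k j == (sigma k i).+1 :> nat) block_mx A X L D i j.
  rewrite big_mkcond big_split_ord /= [X in _ + X]big1 ?addr0 => [|j _]; last first.
    by rewrite /ext1 block_mxEur mxE if_same.
  rewrite [RHS]big_mkcond; apply: eq_bigr => j _.
  by rewrite /ext1 block_mxEul !ae -addSn eqn_add2r.
under eq_bigr do rewrite E; rewrite big_split_ord /=; congr (_ + _).
  apply: eq_bigr => i _; rewrite big_mkcond big_split_ord /= [X in X + _]big1 ?add0r => [|j _].
    rewrite (bigD1 i) //= [X in _ + X]big1 ?addr0 => [|j nj]; rewrite sigma_l sigma_r block_mxEur.
      by rewrite eqxx.
    by case: eqP => // ij; case/eqP: nj; apply: val_inj => /=; lia.
  by rewrite !sigma_l; case: eqP => //; lia.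
apply: eq_bigr => i _; rewrite big_mkcond big_split_ord /= [X in _ + X]big1 ?addr0 => [|j _].
  rewrite [RHS]big_mkcond; apply: eq_bigr => j _.
  rewrite sigma_l sigma_r block_mxEdl -doubleS.
  by rewrite (inj_eq double_inj).
by rewrite !sigma_r; case: eqP => //; lia.
Qed.

Lemma interleave_shifts : shifts_sigma interleave 0.
Proof. by move=> i; rewrite /= addn0. Qed.

Lemma interleave1_shifts : shifts_sigma interleave1 1.
Proof. by move=> i; rewrite /= ltn_ord addn1. Qed.

Lemma placed_Bessel_biequivariant a e : injective a -> shifts_sigma a e ->
  biequivariant psi (placed_Bessel a).
Proof.
move=> a_inj ae A X L D uA tX tL uD Y /=; rewrite /placed_Bessel !ext1_mul.
have [pa sa] := placed_block ae uA tX tL uD.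
have [ps ss] := placed_block interleave_shifts uA tX tL uD.
split; first by rewrite mulmxA -mulmxA Bessel_mx_placed_l // sa mulmxA.
by rewrite mulmxA Bessel_mx_placed_r ?ss //; apply: interleave_inj.
Qed.

(** The last place 2m is preceded by 2m - 1, which is the place of the last
    coordinate of y2. *)
Lemma placed_column (y1 y2 : 'cV[F]_m) :
  let V : 'M[F]_n := block_mx 1%:M (col_mx y1 y2) 0 1%:M in
  placed_unitri interleave V /\ placed_supdiag interleave V = y2 ord_max 0.
Proof.
split=> [i j|].
  have := ltn_ord i; have := ltn_ord j.
  case: (split_ordP i) => {}i ->; case: (split_ordP j) => {}j -> jn iN.
  - by rewrite block_mxEul mxE (inj_eq (@lshift_inj _ _)).
  - rewrite /= /sigma /= => le; exfalso; have := ltn_ord i; rewrite ord1 /= in jn le *.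
    by move: le; repeat (case: ifP => ?); lia.
  - by rewrite block_mxEdl mxE eq_rlshift.
  - by rewrite block_mxEdr mxE (inj_eq (@rshift_inj _ _)).
rewrite /placed_supdiag big_split_ord /= [X in _ + X]big1 ?addr0; last first.
  move=> i _; rewrite big_mkcond big_split_ord /= !big1 ?addr0 // => j _.
    by rewrite !ord1; case: eqP => //; lia.
  by rewrite block_mxEdl mxE if_same.
have sgN : sigma k (rshift (m + m) (ord0 : 'I_1)) = m.*2.
  by rewrite /sigma /=; repeat (case: ifP => ?); lia.
have E (i : 'I_(m + m)) :
    \sum_(j < n | interleave j == (interleave (lshift 1 i)).+1 :> nat)
      (block_mx 1%:M (col_mx y1 y2) 0 1%:M : 'M[F]_n) (lshift 1 i) j
    = if m.*2 == (sigma k i).+1 then (col_mx y1 y2) i 0 else 0.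
  rewrite big_mkcond big_split_ord /= [X in X + _]big1 ?add0r => [|j _]; last first.
    rewrite block_mxEul mxE; case: (i =P j) => [->|_]; last by rewrite if_same.
    by case: eqP => //; lia.
  by rewrite big_ord1 sgN block_mxEur.
under eq_bigr do rewrite E; rewrite big_split_ord /= [X in X + _]big1 ?add0r => [|i _].
  rewrite (bigD1 ord_max) //= big1 ?addr0 => [|i ni].
    by rewrite (sigma_r ord_max) -doubleS eqxx col_mxEd.
  by rewrite (sigma_r i); case: eqP => // E'; case/eqP: ni; apply: val_inj => /=; lia.
by rewrite sigma_l; case: eqP => //; lia.
Qed.

End BesselFunction.

(** * The Jacquet-Shalika sums as Shalika sums *)

Lemma sum_rcosets (gT : finGroupType) (H G : {group gT}) (C : numClosedFieldType)
    (f : gT -> C) : (H \subset G) ->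
    (forall h x, h \in H -> f (h * x)%g = f x) ->
  #|H|%:R * \sum_(A in rcosets H G) f (repr A) = \sum_(x in G) f x.
Proof.
move=> sHG fH; rewrite (set_partition_big _ (rcosets_partition sHG)) /= mulr_sumr.
apply: eq_bigr => _ /rcosetsP[y Gy ->].
rewrite (eq_bigr (fun=> f (repr (H :* y)%g))) => [|x].
  by rewrite sumr_const card_rcoset mulr_natl.
have /rcosetP[h Hh ->] := mem_repr_rcoset H y.
by case/rcosetP => h' Hh' ->; rewrite !fH.
Qed.

Section DoubleAverage.

Variables (F : finFieldType) (C : numClosedFieldType) (k : nat).
Local Notation m := k.+1.

(** Replacing g by U g conjugates X, so that the invariance in g only holds after
    the sum over X is completed. *)
Lemma sum_coset_reprs (Phi : 'M[F]_m -> 'M[F]_m -> C) :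
    (forall g X0 X, utri X0 -> Phi g (X0 + X) = Phi g X) ->
    (forall U g, unitri U -> g \in unitmx -> \sum_X Phi (U *m g) X = \sum_X Phi g X) ->
  #|unip F m|%:R * (#|upper_trig F k|%:R *
    \sum_(Ng in rcosets (unip F m) 'GL_m[F])
      \sum_(BX in rcosets (upper_trig F k) [set: 'M[F]_m])
        Phi (GLval (repr Ng)) (repr BX))
  = \sum_(g : {'GL_m[F]}) \sum_X Phi (GLval g) X.
Proof.
move=> PhiB PhiN.
rewrite [X in _ * X]mulr_sumr.
rewrite (eq_bigr (fun Ng : {set {'GL_m[F]}} => \sum_X Phi (GLval (repr Ng)) X)) => [|Ng _].
  have := @sum_rcosets _ (unip_group F m) (GLgroup_group m F) C (fun g => \sum_X Phi (GLval g) X).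
  rewrite /= => ->; first by apply: eq_bigl => g; rewrite inE.
    exact: subsetT.
  by move=> u g /unipP uu; apply: PhiN => //; apply: (GL_unitmx g).
have := @sum_rcosets _ (upper_trig_group F k) (setT_group 'M[F]_m) C (Phi (GLval (repr Ng))).
rewrite /= => ->; first by apply: eq_bigl => g; rewrite inE.
  exact: subsetT.
by move=> X0 X /upper_trigP tX; apply: PhiB.
Qed.

End DoubleAverage.

Section LongElement.

Variables (F : finFieldType) (n : nat).
Local Notation w := (wlong F n).

Lemma wlong_place : w = place_mx F (@rev_ord n).
Proof. by apply/matrixP => i j; rewrite !mxE -(inj_eq rev_ord_inj) rev_ordK eq_sym. Qed.

Lemma wlong_tr : w^T = w.
Proof. by apply/matrixP => i j; rewrite !mxE -(inj_eq rev_ord_inj) rev_ordK eq_sym. Qed.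

Lemma wlongK : w *m w = 1%:M.
Proof. by rewrite -{1}wlong_tr wlong_place place_trK //; apply: rev_ord_inj. Qed.

Lemma wlong_conj (A : 'M[F]_n) i j : (w *m A *m w) i j = A (rev_ord i) (rev_ord j).
Proof.
rewrite -{2}wlong_tr wlong_place -{1}[i]rev_ordK -{1}[j]rev_ordK.
by rewrite mul_placeE ?place_mulE //; apply: rev_ord_inj.
Qed.

Lemma wlong_conj_utri (X : 'M[F]_n) : utri X -> utri (w *m X^T *m w).
Proof. by move=> tX i j ij; rewrite wlong_conj mxE tX //=; have := ltn_ord i; lia. Qed.

Lemma wlong_conj_unitri (U : 'M[F]_n) : unitri U -> unitri (w *m U^T *m w).
Proof.
move=> uU i j ij; rewrite wlong_conj mxE uU /=; last by have := ltn_ord i; lia.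
by rewrite (inj_eq rev_ord_inj) eq_sym.
Qed.

Lemma wlong_conj_tr (X : 'M[F]_n) : \tr (w *m X^T *m w) = \tr X.
Proof. by rewrite mxtrace_mulC mulmxA wlongK mul1mx mxtrace_tr. Qed.

End LongElement.

Definition invtr (F : finFieldType) n (A : 'M[F]_n) : 'M[F]_n := (invmx A)^T.

Lemma invtr_eq (F : finFieldType) n (A K : 'M[F]_n) : A^T *m K = 1%:M -> invtr A = K.
Proof.
move=> E; have [uA _] := mulmx1_unit E.
by rewrite /invtr trmx_inv -[RHS]mul1mx -(mulVmx uA) -mulmxA E mulmx1.
Qed.

Lemma invtr_mul (F : finFieldType) n (A B : 'M[F]_n) : A \in unitmx -> B \in unitmx ->
  invtr (A *m B) = invtr A *m invtr B.
Proof.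
move=> uA uB; apply: invtr_eq; rewrite trmx_mul mulmxA -(mulmxA B^T) /invtr.
by rewrite -trmx_mul mulVmx // trmx1 mulmx1 -trmx_mul mulVmx // trmx1.
Qed.

Section Integrals.

Variables (F : finFieldType) (C : numClosedFieldType) (psi : F -> C).
Hypothesis psi_char : additive_character psi.
Variable k : nat.
Local Notation m := k.+1.
Local Notation n := (k.+1 + k.+1 + 1)%N.
Variable B : {'GL_n[F]} -> C.
Hypothesis B_bi : forall g u1 u2, u1 \in unip F n -> u2 \in unip F n ->
  B (u1 * g * u2)%g = psi_unip psi u1 * psi_unip psi u2 * B g.

Local Notation u := (fun X : 'M[F]_m => block_mx 1%:M X 0 1%:M : 'M[F]_(m + m)).
Local Notation dbl := (fun g : 'M[F]_m => block_mx g 0 0 g : 'M[F]_(m + m)).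
Local Notation w := (wlong F m).
Local Notation ext1 := (@ext1 F k).
Local Notation P := (place_mx F (@interleave k)).
Local Notation P1 := (place_mx F (@interleave1 k)).
Local Notation f0 := (placed_Bessel B (@interleave k)).
Local Notation f1 := (placed_Bessel B (@interleave1 k)).

Let f0_bi : biequivariant psi f0 :=
  placed_Bessel_biequivariant psi_char B_bi (@interleave_inj k) (@interleave_shifts k).
Let f1_bi : biequivariant psi f1 :=
  placed_Bessel_biequivariant psi_char B_bi (@interleave1_inj k) (@interleave1_shifts k).

(** The test vector h |-> B (h sigma^-1). *)
Definition translated_Bessel : {'GL_n[F]} -> C := rtrans (@toGL F n (P^T)) B.

Definition delta0 (Z : 'rV[F]_m) : C := (Z == 0)%:R.

Lemma sigma_mx_place : sigma_mx F k = P.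
Proof. by apply/matrixP => i j; rewrite !mxE. Qed.

Lemma ext1_unit Y : Y \in unitmx -> ext1 Y \in unitmx.
Proof. by rewrite !unitmxE /ext1 det_ublock det1 mulr1. Qed.

Lemma u_unit X : u X \in unitmx.
Proof. by rewrite unitmxE det_ublock !det1 mulr1 unitr1. Qed.

Lemma dbl_unit g : g \in unitmx -> dbl g \in unitmx.
Proof. by rewrite !unitmxE det_ublock unitrM => ->. Qed.

Definition low_row (Z : 'rV[F]_m) : 'M[F]_n := block_mx 1%:M 0 (row_mx 0 Z) 1%:M.

Lemma low_row_unit Z : low_row Z \in unitmx.
Proof. by rewrite unitmxE det_lblock !det1 mulr1 unitr1. Qed.

Lemma JS_argE (g X : 'M[F]_m) (Z : 'rV[F]_m) : JS_arg g X Z = P *m ext1 (u X) *m ext1 (dbl g) *m low_row Z.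
Proof. by rewrite /JS_arg sigma_mx_place. Qed.

Lemma JS_arg_unit (g X : 'M[F]_m) (Z : 'rV[F]_m) : g \in unitmx -> JS_arg g X Z \in unitmx.
Proof.
move=> ug; rewrite JS_argE !unitmx_mul low_row_unit !ext1_unit ?u_unit ?dbl_unit //.
by rewrite place_unit //; apply: interleave_inj.
Qed.

Lemma tr_P_unit : P^T \in unitmx.
Proof. by rewrite unitmx_tr place_unit //; apply: interleave_inj. Qed.

Lemma translated_BesselE A : A \in unitmx -> translated_Bessel (@toGL F n A) = Bessel_mx B (A *m P^T).
Proof.
move=> uA; have uP := tr_P_unit; rewrite /translated_Bessel /rtrans /Bessel_mx unitmx_mul uA uP /=.
by rewrite -(@toGL_mul F n A).
Qed.

Lemma low_row0 : low_row 0 = 1%:M.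
Proof. by rewrite /low_row row_mx0 -scalar_mx_block. Qed.

Lemma translated_Bessel_JS_arg (g X : 'M[F]_m) : g \in unitmx ->
  translated_Bessel (@toGL F n (JS_arg g X 0)) = f0 (u X *m dbl g).
Proof.
by move=> ug; rewrite translated_BesselE ?JS_arg_unit // JS_argE low_row0 mulmx1 /placed_Bessel ext1_mul !mulmxA.
Qed.

Definition JS_const : C :=
  (#|'GL_m[F] : unip F m|%g%:R * #|[set: 'M[F]_m] : upper_trig F k|%g%:R
     * #|{: 'rV[F]_m}|%:R)^-1.

Local Notation J := (block_mx 0 1%:M 1%:M 0 : 'M[F]_(m + m)).

Lemma sigma_last : sigma k (rshift (m + m) (ord0 : 'I_1)) = m.*2.
Proof. by rewrite /sigma /=; repeat (case: ifP => ?); lia. Qed.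

(** Reversing the 2m + 1 places reverses the order of the pairs {2j, 2j + 1} and
    exchanges the two members of each pair, up to a shift by one which brings the
    last place to the first. *)
Lemma wlong_sigma_swap : wlong F n *m P = P1 *m ext1 (block_mx w 0 0 w) *m ext1 J.
Proof.
have natE (a b : nat) (c : bool) : (a == b) = c -> (a == b)%:R = c%:R :> F by move=> ->.
rewrite -mulmxA -ext1_mul mulmx_block !mul0mx !mulmx0 !mulmx1 !addr0 !add0r.
rewrite wlong_place place_mul; apply/matrixP => i j.
have /codomP[{}i ->] : i \in codom (@interleave1 k) by apply: inj_card_onto (@interleave1_inj k) _ _.
rewrite place_mulE; last exact: interleave1_inj.
rewrite [LHS]mxE -[_ == _]/(nat_of_ord (interleave1 i) == nat_of_ord (rev_ord (interleave j))).
have alS (a : 'I_(m + m)) : interleave1 (lshift 1 a) = (sigma k a).+1 :> nat by rewrite interleave1_shifts addn1.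
have al0 : interleave1 (rshift (m + m) (ord0 : 'I_1)) = 0%N :> nat by rewrite /= ltnNge leq_addr.
have revE (a : 'I_n) : rev_ord (interleave a) = (n - (sigma k a).+1)%N :> nat by [].
have bnd (a : 'I_m) := ltn_ord a.
have wE (a b : 'I_m) : w a b = (b + a == k)%N%:R.
  by rewrite mxE; apply: natE; have := bnd a; have := bnd b; rewrite /=; lia.
case: (split_ordP i) => {}i ->; case: (split_ordP j) => {}j ->; rewrite /ext1 ?(ord1 i) ?(ord1 j).
- rewrite block_mxEul alS revE.
  case: (split_ordP i) => {}i ->; case: (split_ordP j) => {}j ->; have := bnd i; have := bnd j.
  + by rewrite block_mxEul mxE !sigma_l => *; apply: (natE _ _ false); lia.
  + by rewrite block_mxEur wE sigma_l sigma_r => *; apply: natE; lia.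
  + by rewrite block_mxEdl wE sigma_l sigma_r => *; apply: natE; lia.
  + by rewrite block_mxEdr mxE !sigma_r => *; apply: (natE _ _ false); lia.
- by rewrite block_mxEur mxE alS revE sigma_last; apply: (natE _ _ false); lia.
- rewrite block_mxEdl mxE al0 revE; apply: (natE _ _ false).
  by have := sigma_lt (lshift 1 j); rewrite /=; case: (split_ordP j) => {}j ->;
    have := bnd j; rewrite ?sigma_l ?sigma_r; lia.
- by rewrite block_mxEdr mxE al0 revE sigma_last; apply: (natE _ _ true); lia.
Qed.

Lemma J_tr : J^T *m J = 1%:M.
Proof.
by rewrite tr_block_mx !trmx0 trmx1 mulmx_block !mul0mx !mulmx0 !mul1mx !addr0 !add0r -scalar_mx_block.
Qed.

Lemma J_unit : J \in unitmx.
Proof. by have [] := mulmx1_unit J_tr. Qed.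

Definition upper_col (Z : 'rV[F]_m) : 'M[F]_n := block_mx 1%:M (col_mx (- Z^T) 0) 0 1%:M.

Lemma invtr_ext1 (Y : 'M[F]_(m + m)) : Y \in unitmx -> invtr (ext1 Y) = ext1 (invtr Y).
Proof.
move=> uY; apply: invtr_eq; rewrite /ext1 tr_block_mx !trmx0 trmx1 mulmx_block.
rewrite !mul0mx !mulmx0 mulmx1 !addr0 add0r /invtr -trmx_mul mulVmx // trmx1.
by rewrite -scalar_mx_block.
Qed.

Lemma dual_arg (g X : 'M[F]_m) (Z : 'rV[F]_m) : g \in unitmx ->
  wlong F n *m invtr (JS_arg g X Z *m swap_mx F k)
  = P1 *m ext1 (u (- (w *m X^T *m w)) *m dbl (w *m invtr g)) *m upper_col Z.
Proof.
move=> ug; have swapE : swap_mx F k = ext1 J by [].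
have uP : P \in unitmx by apply: place_unit; apply: interleave_inj.
have udg := dbl_unit ug; have uX := u_unit X; have uJ := J_unit; have uZ := low_row_unit Z.
rewrite swapE JS_argE !invtr_mul ?unitmx_mul ?uP ?ext1_unit //.
have -> : invtr P = P by apply: invtr_eq; rewrite place_trK //; apply: interleave_inj.
rewrite !invtr_ext1 // (invtr_eq J_tr).
have -> : invtr (u X) = block_mx 1%:M 0 (- X^T) 1%:M.
  apply: invtr_eq; rewrite tr_block_mx !trmx1 trmx0 mulmx_block !mul0mx !mulmx0 !mul1mx !mulmx1.
  by rewrite ?addr0 ?add0r ?addrN ?addNr -scalar_mx_block.
have -> : invtr (dbl g) = dbl (invtr g).
  apply: invtr_eq; rewrite tr_block_mx !trmx0 mulmx_block !mul0mx !mulmx0 !addr0 add0r.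
  by rewrite /invtr -trmx_mul mulVmx // trmx1 -scalar_mx_block.
have -> : invtr (low_row Z) = block_mx 1%:M (- col_mx 0 Z^T) 0 1%:M.
  apply: invtr_eq; rewrite /low_row tr_block_mx !trmx1 trmx0 tr_row_mx trmx0 mulmx_block.
  by rewrite !mul0mx !mulmx0 !mul1mx !mulmx1 !addr0 ?add0r ?addrN ?addNr -scalar_mx_block.
rewrite !mulmxA wlong_sigma_swap -!mulmxA; congr (_ *m _).
have -> : block_mx 1%:M (- col_mx 0 Z^T) 0 1%:M *m ext1 J = ext1 J *m upper_col Z.
  rewrite /ext1 /upper_col !mulmx_block !mul1mx !mulmx1 !mul0mx !mulmx0 !addr0 !add0r.
  congr (block_mx _ _ _ _); rewrite mul_block_col !mul0mx !mul1mx !addr0.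
  by rewrite ?add0r ?addr0 opp_col_mx oppr0.
rewrite !mulmxA -!ext1_mul; congr (ext1 _ *m _).
rewrite !mulmx_block !mul0mx !mulmx0 !mul1mx !mulmx1 !addr0 !add0r.
by rewrite !mul0mx addr0 mulNmx !mulmxA mulmxN mulNmx -(mulmxA _ w w) wlongK mulmx1.
Qed.

(** The column coming from Z is a unitriangular factor with no superdiagonal
    entry, since it only meets the places of the first block. *)
Lemma translated_Bessel_dual_arg (g X : 'M[F]_m) (Z : 'rV[F]_m) : g \in unitmx ->
  rtrans (@toGL F n (swap_mx F k)) (tildeW translated_Bessel) (@toGL F n (JS_arg g X Z))
  = f1 (u (- (w *m X^T *m w)) *m dbl (w *m invtr g)).
Proof.
move=> ug; have uJS := JS_arg_unit X Z ug.
have uS : swap_mx F k \in unitmx by apply: ext1_unit J_unit.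
have uw : wlong F n \in unitmx by have [] := mulmx1_unit (wlongK F n).
rewrite /rtrans /tildeW -(@toGL_mul F n (JS_arg g X Z)) //.
have uA : JS_arg g X Z *m swap_mx F k \in unitmx by rewrite unitmx_mul uJS.
rewrite toGLK // translated_BesselE; last by rewrite unitmx_mul uw unitmx_tr unitmx_inv.
have -> := dual_arg X Z ug.
have [pz sz] := placed_column (- Z^T) (0 : 'cV[F]_m).
rewrite (Bessel_mx_placed_r psi_char B_bi _ (@interleave_inj k) pz) sz mxE (char0 psi_char) mul1r.
by rewrite /placed_Bessel.
Qed.

Lemma cancel_normalisation (a b c s : C) : a != 0 -> b != 0 -> c / (a * b) * (a * (b * s)) = c * s.
Proof. by move=> a0 b0; field; rewrite a0 b0. Qed.

Lemma JS_numerator :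
  JS psi translated_Bessel delta0 = JS_const / (#|unip F m|%:R * #|upper_trig F k|%:R)
    * \sum_(g : {'GL_m[F]}) \sum_X Shalika_term psi f0 (GLval g) X.
Proof.
have N0 : #|unip F m|%:R != 0 :> C by rewrite pnatr_eq0 -lt0n cardG_gt0.
have B0 : #|upper_trig F k|%:R != 0 :> C by rewrite pnatr_eq0 -lt0n cardG_gt0.
rewrite -sum_coset_reprs => [|g X0 X tX|U g uU ug].
- rewrite cancel_normalisation // /JS -/JS_const; congr (_ * _); apply: eq_bigr => Ng _; apply: eq_bigr => BX _.
  rewrite (bigD1 0) //= [X in _ + X]big1 ?addr0 => [|Z nZ]; last first.
    by rewrite /delta0 (negPf nZ) mulr0.
  by rewrite /delta0 eqxx mulr1 translated_Bessel_JS_arg // (GL_unitmx (repr Ng)).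
- exact: Shalika_term_utri.
- exact: Shalika_sum_unitri_l.
Qed.

Lemma Fourier_delta0 y : Fourier psi delta0 y = sqrtC #|F|%:R ^- m.
Proof.
rewrite /Fourier (bigD1 0) //= [X in _ + X]big1 ?addr0 => [|Z nZ]; last first.
  by rewrite /delta0 (negPf nZ) mul0r.
by rewrite /delta0 eqxx mul0mx mxE (char0 psi_char) !mulr1.
Qed.

Lemma invtr_wlong_inj : injective (fun g : {'GL_m[F]} => @toGL F m (w *m invtr (GLval g))).
Proof.
move=> g h; have uw : w \in unitmx by have [] := mulmx1_unit (wlongK F m).
have ui (g' : {'GL_m[F]}) : w *m invtr (GLval g') \in unitmx.
  by rewrite unitmx_mul uw unitmx_tr unitmx_inv (GL_unitmx g').
move/(congr1 (fun x : {'GL_m[F]} => GLval x)); rewrite !toGLK //.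
move/(congr1 (mulmx w)); rewrite !mulmxA wlongK !mul1mx.
by move/trmx_inj/(can_inj (@invmxK _ _)) => E; apply: val_inj.
Qed.

(** The power q^m is the number of Z, on which the summand does not depend, and
    the power of the square root is the Fourier transform of the test function. *)
Lemma JS_dual :
  dualJS psi translated_Bessel delta0 = JS_const / (#|unip F m|%:R * #|upper_trig F k|%:R)
    * (sqrtC #|F|%:R ^- m * #|F|%:R ^+ m)
    * \sum_(g : {'GL_m[F]}) \sum_X Shalika_term psi f1 (GLval g) X.
Proof.
have N0 : #|unip F m|%:R != 0 :> C by rewrite pnatr_eq0 -lt0n cardG_gt0.
have B0 : #|upper_trig F k|%:R != 0 :> C by rewrite pnatr_eq0 -lt0n cardG_gt0.
have uw : w \in unitmx by have [] := mulmx1_unit (wlongK F m).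
pose Phi (g X : 'M[F]_m) := Shalika_term psi f1 (w *m invtr g) (- (w *m X^T *m w)).
have reX (g : 'M[F]_m) : \sum_X Shalika_term psi f1 g (- (w *m X^T *m w)) = \sum_X Shalika_term psi f1 g X.
  rewrite [RHS](reindex_inj (h := fun X => - (w *m X^T *m w))) // => X Y /oppr_inj.
  move/(congr1 (fun Z => w *m Z *m w)); rewrite !mulmxA wlongK !mul1mx -!mulmxA wlongK !mulmx1.
  exact: trmx_inj.
have -> : \sum_(g : {'GL_m[F]}) \sum_X Shalika_term psi f1 (GLval g) X
    = \sum_(g : {'GL_m[F]}) \sum_X Phi (GLval g) X.
  rewrite [LHS](reindex_inj invtr_wlong_inj) /=; apply: eq_bigr => g _.
  have -> : GLval (@toGL F m (w *m invtr (GLval g))) = w *m invtr (GLval g).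
    by apply: toGLK; rewrite unitmx_mul uw unitmx_tr unitmx_inv (GL_unitmx g).
  exact: esym (reX _).
rewrite -sum_coset_reprs => [|g X0 X tX|U g uU ug].
- rewrite /dualJS /JS -/JS_const.
  set S := \sum_(Ng in _) _; set S' := \sum_(Ng in _) _.
  have -> : S = sqrtC #|F|%:R ^- m * #|F|%:R ^+ m * S'.
    rewrite /S /S' mulr_sumr; apply: eq_bigr => Ng _; rewrite mulr_sumr; apply: eq_bigr => BX _.
    rewrite (eq_bigr (fun=> Phi (GLval (repr Ng)) (repr BX) * sqrtC #|F|%:R ^- m)) => [|Z _].
      by rewrite sumr_const card_mx mul1n -[LHS]mulr_natl natrX mulrA mulrC mulrA.
    rewrite Fourier_delta0 translated_Bessel_dual_arg ?(GL_unitmx (repr Ng)) //; congr (_ * _).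
    rewrite /Phi /Shalika_term; congr (_ * _).
    have -> : \tr (- (w *m (repr BX)^T *m w)) = - \tr (repr BX).
      by rewrite raddfN /= wlong_conj_tr.
    by rewrite /inv_character opprK (charN psi_char) invrK.
  by rewrite [RHS]mulrAC cancel_normalisation // -[RHS]mulrA [S' * _]mulrC.
- rewrite /Phi linearD /= mulmxDr mulmxDl opprD Shalika_term_utri // => i j ij.
  by rewrite mxE wlong_conj_utri ?oppr0.
have Um := unitri_unit uU.
transitivity (\sum_X Shalika_term psi f1 (w *m invtr (U *m g)) X).
  exact: (reX (w *m invtr (U *m g))).
transitivity (\sum_X Shalika_term psi f1 (w *m invtr g) X); last first.
  exact: esym (reX (w *m invtr g)).
have -> : w *m invtr (U *m g) = (w *m invtr U *m w) *m (w *m invtr g).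
  by rewrite invtr_mul // !mulmxA -(mulmxA _ w w) wlongK mulmx1.
have uU' : unitri (w *m invtr U *m w) by apply: wlong_conj_unitri; apply: unitri_inv.
exact: Shalika_sum_unitri_l uU'.
Qed.

End Integrals.

(** * Block antidiagonal matrices *)

Section AntidiagEntries.

Variable F : finFieldType.
Implicit Type l : seq (nat * {unit F}).

Definition scal_block (x : nat * {unit F}) : block F :=
  mkblock ((val x.2)%:M : 'M[F]_(x.1)).

Lemma antidiag_size_scal l : antidiag_size (map scal_block l) = block_total l.
Proof. by elim: l => [|x l IHl]; rewrite ?block_total_cons /= ?IHl // /block_total big_nil. Qed.

Lemma antidiag_scalE l a b :
  antidiag (map scal_block l) a b = val (block_scal l a) * (b == block_col l a :> nat)%:R.
Proof.
elim: l a b => [|x l IHl] a b; first by case: a.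
rewrite /= castmxE /= -antidiag_size_scal.
set b' := cast_ord _ b; have -> : nat_of_ord b = b' by [].
move: b'; rewrite cast_ord_id => {}b; case: (split_ordP a) => {}a ->; case: (split_ordP b) => {}b ->.
- rewrite block_mxEul [LHS]mxE /=; case: eqP => [E|]; rewrite ?mulr0 //.
  by have := ltn_ord b; rewrite E ltnNge leq_addr.
- rewrite block_mxEur !mxE /= eqn_add2l -[_ == _ :> nat]/(b == a) eq_sym.
  by case: eqP => _; rewrite ?mulr1n ?mulr0n ?mulr1 ?mulr0.
- by rewrite block_mxEdl IHl /= addKn.
rewrite block_mxEdr [LHS]mxE /= addKn; case: eqP => [E|]; rewrite ?mulr0 //.
have := @block_col_lt _ l a; rewrite -antidiag_size_scal ltn_ord -E => /(_ isT).
by rewrite ltnNge leq_addr.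
Qed.

Lemma conform_mxE m n m' n' (em : m' = m) (en : n' = n) (A : 'M[F]_(m', n')) (A0 : 'M[F]_(m, n)) i j :
  conform_mx A0 A i j = A (cast_ord (esym em) i) (cast_ord (esym en) j).
Proof.
move: A0 i j; case: m / em; case: n / en => A0 i j.
by rewrite conform_mx_id !cast_ord_id.
Qed.

(** The blocks of antidiag_scal: each size is doubled, and I_1 comes last. *)
Definition double_blocks l := rcons [seq ((2 * x.1)%N, x.2) | x <- l] (1%N, 1%g).

Lemma block_total_double l : block_total (double_blocks l) = (2 * block_total l + 1)%N.
Proof.
rewrite /block_total /double_blocks -cats1 big_cat big_map /= big_cons big_nil -big_distrr /=.
by rewrite addn0.
Qed.

Lemma double_blocks_last l :
  block_col (double_blocks l) (2 * block_total l) = 0%N /\ block_scal (double_blocks l) (2 * block_total l) = 1%g.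
Proof.
elim: l => [|x l [IHc IHs]] /=; first by rewrite /block_total !big_nil.
by rewrite block_total_cons mulnDr ltnNge leq_addr addKn /=.
Qed.

Lemma double_blocksE l i e : (i < block_total l)%N -> (e < 2)%N ->
  block_col (double_blocks l) (2 * i + e) = (1 + 2 * block_col l i + e)%N /\
  block_scal (double_blocks l) (2 * i + e) = block_scal l i.
Proof.
move=> il e2; elim: l i il => [|x l IHl] i; first by rewrite /block_total big_nil.
rewrite block_total_cons /= => il; have -> : (2 * i + e < 2 * x.1)%N = (i < x.1)%N by lia.
case: (ltnP i x.1) => [ix|xi].
  have /= -> := block_total_double l; split=> //; lia.
have := IHl (i - x.1)%N; rewrite (_ : 2 * (i - x.1) + e = 2 * i + e - 2 * x.1)%N; last by lia.
by apply; lia.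
Qed.

End AntidiagEntries.

Section AntidiagScal.

Variables (F : finFieldType) (k : nat).
Local Notation m := k.+1.
Local Notation n := (k.+1 + k.+1 + 1)%N.

(** Since I_1 is the last block, it occupies the first column and the last row:
    rows are interleaved, and columns are interleaved with a shift by one. *)
Lemma antidiag_scal_placed r (mu : {ffun 'I_r -> 'I_k.+2}) (lam : {ffun 'I_r -> {unit F}})
    (v : 'S_m) t :
    composition k (block_list mu lam) -> realizes (block_list mu lam) v t ->
  antidiag_scal mu lam =
  place_mx F (@interleave k) *m ext1 (block_mx (monomial v t) 0 0 (monomial v t))
    *m (place_mx F (@interleave1 k))^T.
Proof.
set l := block_list mu lam => -[_ tl] /realizesP H.
have EL : rcons [seq mkblock ((FinRing.uval (lam i))%:M : 'M[F]_(2 * mu i)) | i <- enum 'I_r]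
      (mkblock (1%:M : 'M[F]_1)) = map (@scal_block F) (double_blocks l).
  by rewrite map_rcons -!map_comp.
rewrite /antidiag_scal EL.
have en : antidiag_size (map (@scal_block F) (double_blocks l)) = n.
  by rewrite antidiag_size_scal block_total_double tl; lia.
apply/matrixP => i j; rewrite (conform_mxE en en) antidiag_scalE /=.
have /codomP[{}i ->] : i \in codom (@interleave k) by apply: inj_card_onto (@interleave_inj k) _ _.
have /codomP[{}j ->] : j \in codom (@interleave1 k) by apply: inj_card_onto (@interleave1_inj k) _ _.
rewrite mul_placeE; last exact: interleave1_inj.
rewrite place_mulE; last exact: interleave_inj.
have alS (a : 'I_(m + m)) : interleave1 (lshift 1 a) = (sigma k a).+1 :> nat by rewrite interleave1_shifts addn1.
have al0 : interleave1 (rshift (m + m) (ord0 : 'I_1)) = 0%N :> nat by rewrite /= ltnNge leq_addr.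
have row (a : 'I_m) (e : nat) (b : nat) : (e < 2)%N ->
    val (block_scal (double_blocks l) (2 * a + e)) * (b == block_col (double_blocks l) (2 * a + e))%:R
    = val (t a) * (b == 1 + 2 * v a + e)%N%:R.
  move=> e2; have [-> ->] := double_blocksE (l := l) (i := a) (e := e) ltac:(by rewrite tl) e2.
  by rewrite -(H a).1 -(H a).2.
have row0 (a : 'I_m) (b : nat) :
    val (block_scal (double_blocks l) a.*2) * (b == block_col (double_blocks l) a.*2)%:R
    = val (t a) * (b == (v a).*2.+1)%:R.
  by have := row a 0%N b isT; rewrite !mul2n !addn0.
have row1 (a : 'I_m) (b : nat) :
    val (block_scal (double_blocks l) a.*2.+1) * (b == block_col (double_blocks l) a.*2.+1)%:R
    = val (t a) * (b == (v a).*2.+2)%:R.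
  by have := row a 1%N b isT; rewrite !mul2n !addn1.
have sgE (a : 'I_(m + m)) : interleave (lshift 1 a) = sigma k a :> nat by [].
have entry (a c : 'I_m) (b d : nat) : (b == d)%N = (c == v a) ->
    val (t a) * (b == d)%:R = monomial v t a c.
  by move=> ->; rewrite mxE.
have entry0 (a : 'I_m) (b d : nat) : (b == d)%N = false -> val (t a) * (b == d)%:R = 0 :> F.
  by move=> ->; rewrite mulr0.
case: (split_ordP i) => {}i ->; rewrite /ext1 ?(ord1 i).
  rewrite sgE; case: (split_ordP i) => {}i ->; rewrite ?sigma_l ?sigma_r ?row0 ?row1;
    case: (split_ordP j) => {}j ->; rewrite ?(ord1 j) ?al0 ?alS.
  - rewrite block_mxEul; case: (split_ordP j) => {}j ->; rewrite ?sigma_l ?sigma_r.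
      by rewrite block_mxEul; apply: entry; rewrite -[RHS]/(nat_of_ord j == v i); lia.
    by rewrite block_mxEur mxE; apply: entry0; lia.
  - by rewrite block_mxEur mxE; apply: entry0.
  - rewrite block_mxEul; case: (split_ordP j) => {}j ->; rewrite ?sigma_l ?sigma_r.
      by rewrite block_mxEdl mxE; apply: entry0; lia.
    by rewrite block_mxEdr; apply: entry; rewrite -[RHS]/(nat_of_ord j == v i); lia.
  by rewrite block_mxEur mxE; apply: entry0.
rewrite -[nat_of_ord (interleave _)]/(sigma k (rshift (m + m) (ord0 : 'I_1))) sigma_last.
have [] := double_blocks_last l; rewrite tl mul2n => -> ->; rewrite mul1r.
case: (split_ordP j) => {}j ->; rewrite ?(ord1 j) ?al0 ?alS; first by rewrite block_mxEdl mxE.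
by rewrite block_mxEdr mxE.
Qed.

Lemma invmx_antidiag_scal r (mu : {ffun 'I_r -> 'I_k.+2}) (lam : {ffun 'I_r -> {unit F}})
    (v : 'S_m) t :
    composition k (block_list mu lam) -> realizes (block_list mu lam) v t ->
  invmx (antidiag_scal mu lam) =
  place_mx F (@interleave1 k) *m ext1 (block_mx (invmx (monomial v t)) 0 0 (invmx (monomial v t)))
    *m (place_mx F (@interleave k))^T.
Proof.
move=> cl rl; rewrite (antidiag_scal_placed cl rl).
set D := ext1 _; set D' := ext1 _.
have DD' : D *m D' = 1%:M.
  rewrite -ext1_mul mulmx_block !mul0mx !mulmx0 !addr0 !add0r mulmxV ?monomial_unit //.
  by rewrite -scalar_mx_block ext1_1.
have E : place_mx F (@interleave k) *m D *m (place_mx F (@interleave1 k))^T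
    *m (place_mx F (@interleave1 k) *m D' *m (place_mx F (@interleave k))^T) = 1%:M.
  rewrite !mulmxA -(mulmxA _ (_^T) (place_mx F (@interleave1 k))) place_trK; last exact: interleave1_inj.
  rewrite mulmx1 -(mulmxA _ D D') DD' mulmx1 place_Ktr //; exact: interleave_inj.
have [uA _] := mulmx1_unit E.
by rewrite -[LHS]mulmx1 -E mulKmx.
Qed.

End AntidiagScal.

(** * The formula *)

Section Main.

Variables (F : finFieldType) (C : numClosedFieldType) (psi : F -> C).
Hypothesis psi_char : additive_character psi.
Hypothesis psi_nontrivial : nontrivial_character psi.
Variable k : nat.
Local Notation m := k.+1.
Local Notation n := (k.+1 + k.+1 + 1)%N.
Variable B : {'GL_n[F]} -> C.
Hypothesis B1 : B 1%g = 1.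
Hypothesis B_bi : forall g u1 u2, u1 \in unip F n -> u2 \in unip F n ->
  B (u1 * g * u2)%g = psi_unip psi u1 * psi_unip psi u2 * B g.

Local Notation f0 := (placed_Bessel B (@interleave k)).
Local Notation f1 := (placed_Bessel B (@interleave1 k)).
Local Notation dbl := (fun g : 'M[F]_m => block_mx g 0 0 g : 'M[F]_(m + m)).
Local Notation q := (#|F|%:R : C).
Local Notation K := (#|unip F m|%:R ^+ 2 * q ^+ (m * m)).

Let f0_bi : biequivariant psi f0 :=
  placed_Bessel_biequivariant psi_char B_bi (@interleave_inj k) (@interleave_shifts k).
Let f1_bi : biequivariant psi f1 :=
  placed_Bessel_biequivariant psi_char B_bi (@interleave1_inj k) (@interleave1_shifts k).

Lemma f1_sum :
  \sum_(g : {'GL_m[F]}) \sum_X Shalika_term psi f1 (GLval g) X =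
  K * \sum_(1 <= r < k.+2)
      \sum_(mu : {ffun 'I_r -> 'I_k.+2} | [forall i, (0 < mu i)%N] && (\sum_i mu i == m)%N)
        \sum_(lam : {ffun 'I_r -> {unit F}})
          q ^- (\sum_i 2 * 'C(mu i, 2)) * B (@toGL F n (invmx (antidiag_scal mu lam))).
Proof.
rewrite (Shalika_sum psi_char psi_nontrivial f1_bi); congr (_ * _).
pose Nl (l : seq (nat * {unit F})) : 'M[F]_m :=
  \matrix_(i, j) (val (block_scal l i) * (j == block_col l i :> nat)%:R).
have NlE l v t : realizes l v t -> Nl l = monomial v t.
  move=> /realizesP H; apply/matrixP => i j; rewrite !mxE -(H i).1 -(H i).2.
  by rewrite -[_ == _ :> nat]/(j == v i).
pose G (l : seq (nat * {unit F})) := q ^- (2 * \sum_(x <- l) 'C(x.1, 2)) * f1 (dbl (invmx (Nl l))).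
rewrite (sum_monomial_compositions (G := G)) => [|v t H0|v t l cl rl].
- apply: eq_bigr => r _; apply: eq_bigr => mu mu_ok; apply: eq_bigr => lam _.
  have cl := block_list_composition lam mu_ok.
  have [v [t rvt]] := realizes_exists cl.2.
  rewrite /G (NlE _ _ _ rvt) sum_block_list big_distrr /=; congr (_ * _).
  rewrite /placed_Bessel -(invmx_antidiag_scal cl rvt) /Bessel_mx ifT // unitmx_inv.
  rewrite (antidiag_scal_placed cl rvt) !unitmx_mul unitmx_tr !place_unit ?ext1_unit //.
  + by rewrite dbl_unit // monomial_unit.
  + exact: interleave1_inj.
  + exact: interleave_inj.
- apply: special_realized => i j; apply: (biequiv_monomial_supp psi_char psi_nontrivial f1_bi).
  by apply: contraNneq H0 => ->; rewrite mulr0.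
by rewrite /G (NlE _ _ _ rl) (card_concordant cl.2 rl).
Qed.

(** The matrix diag (Y, 1) moves a last column y to Y y, and the character reads
    the last coordinates of both. *)
Lemma f0_last_entry g : f0 (dbl g) != 0 -> g ord_max ord_max = 1.
Proof.
move=> fg; apply/eqP; rewrite eq_sym -subr_eq0; apply: contraT.
case/(char_scale_nontrivial psi_nontrivial) => c /eqP[].
pose y : 'cV[F]_m := c *: delta_mx ord_max 0.
have yE (A : 'M[F]_m) : (A *m y) ord_max 0 = c * A ord_max ord_max.
  rewrite /y -scalemxAr mxE mxE (bigD1 ord_max) //= big1 ?addr0 => [|i ni].
    by rewrite mxE !eqxx mulr1.
  by rewrite mxE (negPf ni) mulr0.
have [p1 s1] := placed_column (0 : 'cV[F]_m) y.
have [p2 s2] := placed_column (0 : 'cV[F]_m) (g *m y).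
have E : ext1 (dbl g) *m block_mx 1%:M (col_mx 0 y) 0 1%:M
    = block_mx 1%:M (col_mx 0 (g *m y)) 0 1%:M *m ext1 (dbl g).
  rewrite /ext1 !mulmx_block !mul1mx !mulmx1 !mul0mx !mulmx0 !addr0 !add0r.
  by rewrite mul_block_col !mul0mx !mulmx0 addr0 add0r.
have fE : psi c * f0 (dbl g) = psi (c * g ord_max ord_max) * f0 (dbl g).
  have yc : y ord_max 0 = c by rewrite !mxE !eqxx mulr1.
  rewrite -{1}yc -(yE g) -s1 -s2 /placed_Bessel.
  transitivity (Bessel_mx B (place_mx F (@interleave k) *m (ext1 (dbl g) *m block_mx 1%:M (col_mx 0 y) 0 1%:M)
    *m (place_mx F (@interleave k))^T)).
    by rewrite mulmxA (Bessel_mx_placed_r psi_char B_bi _ (@interleave_inj k) p1).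
  rewrite E mulmxA -mulmxA (Bessel_mx_placed_l psi_char B_bi _ (@interleave_inj k) p2).
  by rewrite mulmxA.
rewrite mulrBr mulr1 (charD psi_char) (charN psi_char).
by rewrite (mulIf fg fE) divff //; apply: char_neq0.
Qed.

(** The last row of a contributing matrix is fixed by v. As v (i + 1) is at most
    v i + 1, this gives i <= v i for all i, from the last row upwards. *)
Lemma f0_monomial_supp (v : 'S_m) t : f0 (dbl (invmx (monomial v t))) != 0 ->
  v = 1%g /\ t = [ffun=> 1%g].
Proof.
move=> fg; have special i j := biequiv_monomial_supp psi_char psi_nontrivial f0_bi (i := i) (j := j) fg.
have last := f0_last_entry fg.
have vt i : val (t i) * invmx (monomial v t) (v i) ord_max = (i == ord_max)%:R.
  by rewrite -mul_monomial mulmxV ?monomial_unit // mxE.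
have [v_max t_max] : v ord_max = ord_max /\ t ord_max = 1%g.
  have := vt ((v^-1)%g ord_max); rewrite permKV last mulr1.
  case: eqP => [E tE|_ /eqP]; last by rewrite (negPf (unitF_neq0 _)).
  split; first by rewrite -{1}E permKV.
  by apply: val_inj; rewrite -[RHS]tE E.
have down (P : 'I_m -> Prop) : P ord_max ->
    (forall i j : 'I_m, j = i.+1 :> nat -> P j -> P i) -> forall i, P i.
  move=> Pmax Pstep i; move E: (k - i)%N => d; elim: d i E => [|d IHd] i E.
    by have -> : i = ord_max by apply: val_inj => /=; have := ltn_ord i; lia.
  have ik : (i.+1 < m)%N by lia.
  by apply: (Pstep i (Ordinal ik)) => //; apply: IHd => /=; lia.
have v1 : v = 1%g.
  apply: perm_ge_id; apply: down => [|i j ji]; first by rewrite v_max.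
  by case: (special i j ji) => [|[]]; lia.
split=> //; apply/ffunP; apply: down => [|i j ji tj]; first by rewrite t_max ffunE.
case: (special i j ji) => [|[_ ->]]; first by rewrite v1 !perm1; lia.
by rewrite tj !ffunE.
Qed.

Lemma f0_sum :
  \sum_(g : {'GL_m[F]}) \sum_X Shalika_term psi f0 (GLval g) X = K * q ^- (2 * 'C(m, 2)).
Proof.
rewrite (Shalika_sum psi_char psi_nontrivial f0_bi); congr (_ * _).
rewrite pair_big /= (@sum_indicator _ _ _ _ (1%g, [ffun=> 1%g])) //=; last first.
  move=> [v t] _ /= nvt; apply/eqP; rewrite mulf_eq0 orbC.
  case: (eqVneq (f0 _) 0) => //= /f0_monomial_supp[vE tE].
  by rewrite vE tE eqxx in nvt.
have -> : @monomial F m 1%g [ffun=> 1%g] = 1%:M.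
  by apply/matrixP => i j; rewrite !mxE ffunE perm1 mul1r eq_sym.
rewrite invmx1 -scalar_mx_block /placed_Bessel ext1_1 mulmx1 place_Ktr; last exact: interleave_inj.
rewrite /Bessel_mx unitmx1 (_ : toGL 1%:M = 1%g) ?B1 ?mulr1; last by apply: val_inj; apply: toGLK; apply: unitmx1.
congr (_ ^- (2 * _)); rewrite -(sum_ltn_ord m) pair_big /= -sum1_card big_mkcond /=.
by apply: eq_bigr => -[i j] _; rewrite inE /= !perm1 andbb; case: ifP.
Qed.

End Main.

Lemma Whittaker_model_rtrans (F : finFieldType) (C : numClosedFieldType) n d
    (rG : mx_representation C 'GL_n[F] d) (psi : F -> C) W h :
  Whittaker_model rG psi W -> Whittaker_model rG psi (rtrans h W).
Proof.
case=> l [v [l0 lW WE]]; exists l, (rG h *m v); split=> // g.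
by rewrite /rtrans WE repr_mxM ?inE // mulmxA.
Qed.

Theorem theorem2p32 (F : finFieldType) (C : numClosedFieldType) (psi : F -> C)
    (psi_char : additive_character psi)
    (psi_nontrivial : nontrivial_character psi)
    (k d : nat) (rG : mx_representation C 'GL_(k.+1 + k.+1 + 1)[F] d)
    (rG_irr : mx_irreducible rG) (rG_cusp : cuspidal rG)
    (B : {'GL_(k.+1 + k.+1 + 1)[F]} -> C) (B_Bessel : is_Bessel rG psi B)
    (gamma : C) (gamma_ext2 : is_ext_square_gamma rG psi gamma) :
  gamma =
    sqrtC #|F|%:R ^+ k.+1 * #|F|%:R ^+ (2 * 'C(k.+1, 2))
    * \sum_(1 <= r < k.+2)
      \sum_(mu : {ffun 'I_r -> 'I_k.+2}
            | [forall i, (0 < mu i)%N] && (\sum_i mu i == k.+1)%N)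
      \sum_(lam : {ffun 'I_r -> {unit F}})
        #|F|%:R ^- (\sum_i 2 * 'C(mu i, 2))
        * B (@toGL F (k.+1 + k.+1 + 1) (invmx (antidiag_scal mu lam))).
Proof.
case: B_Bessel => WB B1 B_bi; case: gamma_ext2 => _ /(_ _ (@delta0 F C k)).
move/(_ _ (Whittaker_model_rtrans _ WB)) => /(_ (@toGL F (k.+1 + k.+1 + 1) (place_mx F (@interleave k))^T)).
rewrite -/(translated_Bessel B) (JS_dual psi_char B_bi) (JS_numerator psi_char B_bi).
rewrite (f1_sum psi_char psi_nontrivial B_bi) (f0_sum psi_char psi_nontrivial B1 B_bi).
set S := \sum_(1 <= r < k.+2) _; set c := JS_const _ _ _ / _.
have q0 : #|F|%:R != 0 :> C by rewrite pnatr_eq0 -lt0n; apply/card_gt0P; exists 0.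
have N0 : #|unip F k.+1|%:R != 0 :> C by rewrite pnatr_eq0 -lt0n cardG_gt0.
have c0 : c != 0.
  rewrite /c /JS_const !mulf_neq0 ?invr_eq0 ?mulf_neq0 ?pnatr_eq0 -?lt0n ?cardG_gt0 //.
  by apply/card_gt0P; exists 0.
have s0 : sqrtC #|F|%:R != 0 :> C by rewrite sqrtC_eq0.
have sE : sqrtC #|F|%:R ^- k.+1 * #|F|%:R ^+ k.+1 = sqrtC #|F|%:R ^+ k.+1 :> C.
  by rewrite -{2}[#|F|%:R]sqrtCK -exprM mul2n -addnn exprD mulKf ?expf_neq0.
set K := _ ^+ 2 * _; have K0 : K != 0 by rewrite mulf_neq0 ?expf_neq0.
rewrite sE -mulrA (mulrCA gamma) => /(mulfI c0); rewrite mulrCA (mulrCA gamma) => /(mulfI K0).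
move=> E; rewrite mulrAC E -mulrA mulVf ?mulr1 ?expf_neq0 //.
Qed.
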